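(* Let $d\ge 2$ be an integer, $q$ a power of a prime $p$ with $q\equiv 1\pmod d$, $t=\frac{q-1}{d}$, $T$ a generator of $\widehat{\mathbb F_q^{\times}}$, and $\lambda\in\mathbb F_q^\times$. Then \begin{align*} \#X_{\lambda}^d(\mathbb F_q)&=\frac{q^{d-1}-1}{q-1}+q^{d-2}\,{}_{d-1}F_{d-2}\left(\left.\begin{array}{cccc}T^t&T^{2t}&\ldots&T^{(d-1)t}\\ {}&\epsilon&\ldots&\epsilon\end{array}\right|\frac{1}{\lambda^d}\right)_q\\ &\quad+\frac1q\sum_{w\in W^{**}}\prod_{i=1}^d g(T^{w_it})+\frac{1}{q-1}\sum_{[w]\in W/\sim,\ [w]\neq[0]}\ \sum_{j=0}^{q-2}\frac{\prod_{i=1}^d g(T^{w_it+j})}{g(T^{dj})}\,T^{dj}(d\lambda). \end{align*}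
   Context: $X_\lambda^d$ is the Dwork hypersurface in $\mathbb P^{d-1}$ defined by $x_1^d+\cdots+x_d^d=d\lambda x_1x_2\cdots x_d$, and $\#X_\lambda^d(\mathbb F_q)$ its number of $\mathbb F_q$-rational points. $W$ is the set of $d$-tuples $w=(w_1,\dots,w_d)$ of integers with $0\le w_i<d$ and $\sum_i w_i\equiv0\pmod d$; $w\sim w'$ if $w-w'$ is congruent modulo $d$ to a multiple of $(1,\dots,1)$; the inner summand depends only on the class $[w]$, and $[0]$ is the class of $(0,\dots,0)$. $W^{**}\subset W$ is the set of tuples with all $w_i\ne0$ and the $w_i$ not all equal. Characters are extended by $\chi(0)=0$; $\epsilon$ is the trivial character. With $\mathrm{tr}:\mathbb F_q\to\mathbb F_p$ the trace, $\zeta$ a fixed primitive $p$-th root of unity and $\theta(x)=\zeta^{\mathrm{tr}(x)}$, the Gauss sum is $g(\chi)=\sum_{x\in\mathbb F_q}\chi(x)\theta(x)$. For characters $A,B$, $\binom{A}{B}:=\frac{B(-1)}{q}\sum_{x\in\mathbb F_q}A(x)\overline B(1-x)$, and Greene's function is ${}_{n+1}F_n\left(\left.\begin{array}{ccc}A_0&\ldots&A_n\\ &B_1\ldots&B_n\end{array}\right|x\right)_q:=\frac{q}{q-1}\sum_\chi\binom{A_0\chi}{\chi}\prod_{i=1}^n\binom{A_i\chi}{B_i\chi}\chi(x)$, summed over all characters $\chi$. *)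

(* Defs.v *)
From HB Require Import structures.
From mathcomp Require Import all_boot all_order all_algebra all_fingroup all_solvable all_field all_character.
Set Implicit Arguments. Unset Strict Implicit. Unset Printing Implicit Defensive.
Import Order.TTheory GRing.Theory Num.Theory.
Local Open Scope ring_scope.

Section Dwork.
Variable F : finFieldType.

Definition qF : nat := #|F|.

Definition is_mchar (chi : F -> algC) : Prop :=
  chi 0 = 0 /\ chi 1 = 1 /\ forall x y, chi (x * y) = chi x * chi y.

(* T generates the character group (of order q-1): its order is q-1 *)
Definition is_char_generator (T : F -> algC) : Prop :=
  is_mchar T /\
  forall k : nat, (forall x : F, x != 0 -> T x ^+ k = 1) -> (qF.-1 %| k)%N.

(* the k-th power of a character, with chi^k(0) = 0 (so T^0 = epsilon) *)
Definition chpow (chi : F -> algC) (k : nat) : F -> algC :=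
  fun x => if x == 0 then 0 else chi x ^+ k.

Definition eps : F -> algC := fun x => if x == 0 then 0 else 1.

Definition chmul (A B : F -> algC) : F -> algC := fun x => A x * B x.

(* All characters of F_q^x: the (linear) irreducible characters of the
   abelian group {unit F}, extended by 0 at 0. *)
Definition unitsG : {group {unit F}} := [set: {unit F}]%G.

Definition char_of (i : Iirr unitsG) : F -> algC :=
  fun x => if @insub F (fun y => y \is a GRing.unit) {unit F} x is Some u
           then 'chi[unitsG]_i u else 0.

(* absolute trace F_q -> F_p, with q = p^(logn p q) *)
Definition trF (p : nat) (x : F) : F := \sum_(i < logn p qF) x ^+ (p ^ i).

Definition tr_nat (p : nat) (x : F) : nat :=
  if [pick k : 'I_p | (k%:R : F) == trF p x] is Some k then val k else 0%N.

Definition theta (p : nat) (zeta : algC) (x : F) : algC := zeta ^+ tr_nat p x.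

Definition gauss (p : nat) (zeta : algC) (chi : F -> algC) : algC :=
  \sum_(x : F) chi x * theta p zeta x.

Definition jbinom (A B : F -> algC) : algC :=
  B (-1) / (qF%:R) * \sum_(x : F) A x * (B (1 - x))^*.

(* Greene's function {}_{n+1}F_n (A_0 ... A_n ; B_1 ... B_n | x)_q, with
   A i for i : 'I_n.+1 and B_(k+1) = B k for k : 'I_n. *)
Definition greeneF (n : nat) (A : 'I_n.+1 -> F -> algC) (B : 'I_n -> F -> algC)
    (x : F) : algC :=
  qF%:R / (qF%:R - 1) *
  \sum_(i : Iirr unitsG)
     (jbinom (chmul (A ord0) (char_of i)) (char_of i) *
      \prod_(k < n) jbinom (chmul (A (lift ord0 k)) (char_of i))
                           (chmul (B k) (char_of i)) *
      char_of i x).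

(* number of F-points of x_1^d + ... + x_d^d = d lambda x_1 ... x_d in P^(d-1):
   points are counted via the unique representative whose first nonzero
   coordinate equals 1. *)
Definition proj_normalized (d : nat) (x : {ffun 'I_d -> F}) : bool :=
  [exists i, (x i == 1) && [forall j : 'I_d, ((j < i)%N) ==> (x j == 0)]].

Definition dwork_count (d : nat) (lam : F) : nat :=
  #|[set x : {ffun 'I_d -> F} | proj_normalized x &&
      (\sum_i x i ^+ d == d%:R * lam * \prod_i x i)]|.

End Dwork.

Definition Wset (d : nat) : {set {ffun 'I_d -> 'I_d}} :=
  [set w : {ffun 'I_d -> 'I_d} | ((\sum_i (w i : nat)) %% d == 0)%N].

Definition Wequiv (d : nat) (w w' : {ffun 'I_d -> 'I_d}) : bool :=
  [exists c : 'I_d, [forall i, ((w' i + c) %% d == (w i : nat) %% d)%N]].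

Definition Wclass (d : nat) (w : {ffun 'I_d -> 'I_d}) : {set {ffun 'I_d -> 'I_d}} :=
  [set w' in Wset d | Wequiv w w'].

Definition Wclasses (d : nat) : {set {set {ffun 'I_d -> 'I_d}}} :=
  [set Wclass w | w in Wset d].

Definition is_zero_class (d : nat) (C : {set {ffun 'I_d -> 'I_d}}) : bool :=
  [exists w in C, [forall i, (w i : nat) == 0%N]].

Definition Wss (d : nat) : {set {ffun 'I_d -> 'I_d}} :=
  [set w in Wset d | [forall i, (w i : nat) != 0%N] &&
                     ~~ [forall i, forall j, w i == w j]].

Definition sum_classes (d : nat) (P : pred {set {ffun 'I_d -> 'I_d}})
    (f : {ffun 'I_d -> 'I_d} -> algC) : algC :=
  \sum_(C in Wclasses d | P C)
     (if [pick w in C] is Some w then f w else 0).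

(* Main.v *)
Require Import Defs.
From HB Require Import structures.
From mathcomp Require Import all_boot all_order all_algebra all_fingroup all_solvable all_field all_character.
From mathcomp Require Import ring.
Import Order.TTheory GRing.Theory Num.Theory.
Set Implicit Arguments. Unset Strict Implicit. Unset Printing Implicit Defensive.
Local Open Scope ring_scope.

(* Detecting the equation with an additive character and expanding it in
   multiplicative characters gives the number of points as a sum of products of
   Gauss sums indexed by pairs (w, j), with w in W and j modulo q-1.  The class
   [w] = [0] together with the nonzero constant tuples of the Fermat
   hypersurface is Greene's function, because its binomials are Jacobi sums and
   their product collapses by the Hasse-Davenport product formula.

   The product formula is proved through L-series over F[u].  The function
   f |-> chi(product of roots)^d psi(sum of d-th powers of roots) is
   multiplicative on monic f.  The logarithmic derivative of its L-series is a
   sum over the points of the finite extensions, and grouping these points by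
   their d-th powers factors the series as \prod_i (1 + g(chi rho^i) t).  On the
   other hand, by Newton's identities the sum of d-th powers of the roots of a
   monic f of degree d is -d f(0) plus a term that does not involve f(0), so the
   coefficient of t^d is chi(d)^(-d) g(chi^d) times a constant independent of
   chi, which the trivial chi determines. *)

(** * Polynomials and periodic points *)

(** The Gauss sums of a character chi and of its inverse multiply to chi(-1) q when chi is
    nontrivial, but to 1 when it is trivial. This exception gives the formula its exact shape. It
    occurs for [T^(dj)] when d j is 0 modulo q - 1, that is, when t divides j. In the point count
    the corrections at these j cancel against the torus part of the Fermat hypersurface, because
    shifting j by t merely permutes W. In Greene's function they leave [(q - 1) / q * G j ^+ d] at j
    = c t with 0 < c < d, and these are the constant tuples that W** leaves out; at j = 0 two
    exceptions compensate each other. The equation with coefficient d lambda is compared with the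
    one with coefficient 0 because the two agree at every point with a zero coordinate, and the
    multiplicative expansion of the monomial term is valid only where the monomial is nonzero. *)

Lemma dvdp_prod_XsubC_count (K : fieldType) (s r : seq K) :
  (\prod_(a <- s) ('X - a%:P) %| \prod_(a <- r) ('X - a%:P)) <->
  (forall y, (count_mem y s <= count_mem y r)%N).
Proof.
split=> [dv y | /count_subseqP[u /perm_to_subseq[v rv] su]].
  rewrite -!mu_prod_XsubC mup_geq ?monic_neq0 ?monic_prod_XsubC //.
  apply: dvdp_trans dv.
  by rewrite -mup_geq ?monic_neq0 ?monic_prod_XsubC.
by rewrite (perm_big _ su) (perm_big _ rv) big_cat dvdp_mulr.
Qed.

Section Periodic.
Variables (T : eqType) (f : T -> T).
Hypothesis injf : injective f.

Lemma traject_inj_period (x : T) (m : nat) :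
  ~~ uniq (traject f x m.+1) -> exists2 l, (0 < l <= m)%N & iter l f x = x.
Proof.
rewrite looping_uniq negbK => /trajectP[i lt_im e].
exists (m - i)%N; first by rewrite subn_gt0 lt_im leq_subr.
have inj_iter j : injective (iter j f) by elim: j => // j IH y z /injf /IH.
by apply: (inj_iter i); rewrite -iterD subnKC // ltnW.
Qed.

Lemma uniq_traject_minimal (x : T) (l : nat) :
  (forall j, (0 < j < l)%N -> iter j f x <> x) -> uniq (traject f x l).
Proof.
case: l => // l H; apply/negPn/negP => /traject_inj_period[j /andP[j0 jl] e].
by apply: (H j) => //; rewrite j0.
Qed.

Lemma iter_mul_period (x : T) (l j : nat) :
  iter l f x = x -> iter (j * l) f x = x.
Proof. by move=> e; elim: j => // j IH; rewrite mulSn iterD IH. Qed.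

Lemma count_traject_mul (x y : T) (l j : nat) : iter l f x = x ->
  count_mem y (traject f x (j * l)) = (j * count_mem y (traject f x l))%N.
Proof.
by move=> e; elim: j => // j IH; rewrite !mulSn trajectD count_cat e IH.
Qed.

Lemma iter_period_dvdn (x : T) (l k : nat) : (0 < l)%N -> iter l f x = x ->
  (forall j, (0 < j < l)%N -> iter j f x <> x) ->
  (iter k f x == x) = (l %| k)%N.
Proof.
move=> l0 e H; apply/eqP/idP => [ek | /dvdnP[j ->]]; last exact: iter_mul_period.
rewrite /dvdn; case: posnP => // pos.
case: (H (k %% l)%N); first by rewrite pos ltn_mod.
by move: ek; rewrite {1}(divn_eq k l) addnC iterD iter_mul_period.
Qed.
End Periodic.

(** The contributing k are l, 2l, ..., a l. In [count_periods], l is the orbit length of a root and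
    a its multiplicity. *)
Lemma sum_multiples_bounded (l a m : nat) : (0 < l)%N -> (a * l <= m)%N ->
  (\sum_(1 <= k < m.+1) ((l %| k) && (k %/ l <= a)) = a)%N.
Proof.
move=> l0 am; rewrite -big_mkcond /= -big_filter sum1_size.
have: perm_eq [seq k <- index_iota 1 m.+1 | ((l %| k) && (k %/ l <= a))%N]
              [seq (j * l)%N | j <- index_iota 1 a.+1].
  apply: uniq_perm; first by rewrite filter_uniq ?iota_uniq.
    rewrite map_inj_uniq ?iota_uniq // => i j /eqP; rewrite eqn_pmul2r //.
    by move/eqP.
  move=> k; rewrite mem_filter mem_index_iota; apply/idP/mapP.
    case/andP=> /andP[/dvdnP[j ->]]; rewrite mulnK // => ja /andP[j0 _].
    by exists j; rewrite // mem_index_iota ltnS ja andbT; case: j j0 {ja}.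
  case=> j; rewrite mem_index_iota ltnS => /andP[j0 ja] ->.
  rewrite dvdn_mull // mulnK // ja ltnS muln_gt0 j0 l0 /=.
  by apply: leq_trans am; rewrite leq_mul2r ja orbT.
by move/perm_size->; rewrite size_map size_iota subn1.
Qed.

(** * Newton's identities and translation of the constant term *)

Section Newton.
Variable K : fieldType.
Implicit Types (rs ss : seq K) (c : K).

Lemma deriv_prod_XsubC rs (P := \prod_(a <- rs) ('X - a%:P)) :
  P^`() = \sum_(a <- rs) P %/ ('X - a%:P).
Proof.
rewrite {}/P; elim: rs => [|b rs IH]; first by rewrite !big_nil derivE.
rewrite !big_cons derivM derivXsubC mul1r IH mulKp ?polyXsubC_eq0 //.
congr (_ + _); rewrite mulr_sumr; apply: eq_big_seq => a ars.
rewrite divp_mulA // dvdp_XsubCl root_prod_XsubC //.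
Qed.

(** Synthetic division: the recurrence [Q_j = P_(j+1) + a Q_(j+1)] is unrolled downwards from the
    vanishing coefficient [Q_n]. *)
Lemma coef_div_XsubC rs a i (n := size rs) (P := \prod_(a <- rs) ('X - a%:P)) :
  a \in rs -> (i < n)%N ->
  (P %/ ('X - a%:P))`_(n - i.+1) = \sum_(s < i.+1) a ^+ s * P`_(n - i + s).
Proof.
move=> ars; have /divpK : 'X - a%:P %| P by rewrite dvdp_XsubCl root_prod_XsubC.
set Q := P %/ _ => PQ.
have rec j : Q`_j = P`_j.+1 + a * Q`_j.+1.
  by rewrite -PQ mulrBr coefB coefMX coefMC /= mulrC subrK.
have Qn : Q`_n = 0.
  apply/nth_default; rewrite /Q size_divp ?polyXsubC_eq0 // size_XsubC.
  by rewrite size_prod_XsubC subn1.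
elim: i => [|i IH] lt_in; rewrite rec -subSn // subSS.
  by rewrite big_ord1 subn0 addn0 Qn mulr0 addr0 expr0 mul1r.
rewrite big_ord_recl /= addn0 expr0 mul1r IH ?(ltnW lt_in) // mulr_sumr.
congr (_ + _); apply: eq_bigr => s _; rewrite mulrA -exprS /bump /=.
by rewrite add1n subnS -(subnSK (ltnW lt_in)) subnS addSnnS.
Qed.

(** Compares coefficients in the expansion of P' as the sum of the quotients P / (X - a). *)
Lemma newton_identity rs i (n := size rs) (P := \prod_(a <- rs) ('X - a%:P)) :
  (i < n)%N ->
  P`_(n - i) *+ (n - i) = \sum_(s < i.+1) (\sum_(a <- rs) a ^+ s) * P`_(n - i + s).
Proof.
move=> lt_in; have := congr1 (fun Q : {poly K} => Q`_(n - i.+1)) (deriv_prod_XsubC rs).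
rewrite /= coef_deriv -subSn // subSS => ->.
rewrite coef_sum (eq_big_seq _ (fun a ars => coef_div_XsubC ars lt_in)).
by rewrite exchange_big; apply: eq_bigr => s _; rewrite mulr_suml.
Qed.

Lemma coef_addC (P : {poly K}) c j : (0 < j)%N -> (P + c%:P)`_j = P`_j.
Proof. by case: j => // j _; rewrite coefD coefC addr0. Qed.

(** For i < n, Newton's identity computes the i-th power sum from earlier ones and from coefficients
    of index at least n - i > 0, so the constant term never enters. *)
Lemma power_sum_shift_lt rs ss c i :
  size ss = size rs -> (i < size rs)%N ->
  \prod_(a <- ss) ('X - a%:P) = \prod_(a <- rs) ('X - a%:P) + c%:P ->
  \sum_(a <- ss) a ^+ i = \sum_(a <- rs) a ^+ i.
Proof.
move=> sz; elim/ltn_ind: i => i IH lt_in e.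
have := newton_identity lt_in; have := @newton_identity ss i.
rewrite sz => /(_ lt_in); rewrite !big_ord_recr /= subnK ?(ltnW lt_in) //.
have cn (ts : seq K) : size ts = size rs ->
    (\prod_(a <- ts) ('X - a%:P))`_(size rs) = 1.
  move=> st; have /monicP := monic_prod_XsubC ts xpredT id.
  by rewrite /lead_coef size_prod_XsubC st.
rewrite !cn // !mulr1 e => E1 E2; apply: (addrI
  (\sum_(s < i) (\sum_(a <- rs) a ^+ s) *
     (\prod_(a <- rs) ('X - a%:P))`_(size rs - i + s))).
rewrite -E2 -(@coef_addC _ c) ?subn_gt0 // E1; congr (_ + _).
apply: eq_bigr => s _; rewrite IH // ?(ltn_trans _ lt_in) //.
by rewrite coef_addC // addn_gt0 subn_gt0 lt_in.
Qed.

(** Summing P(a) = 0 over the roots expresses the n-th power sum by the lower ones. The constant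
    term of P is multiplied by the zeroth power sum, which is n; this is the only place where c
    shows. *)
Lemma power_sum_shift rs ss c :
  size ss = size rs -> (0 < size rs)%N ->
  \prod_(a <- ss) ('X - a%:P) = \prod_(a <- rs) ('X - a%:P) + c%:P ->
  \sum_(a <- ss) a ^+ size rs =
  \sum_(a <- rs) a ^+ size rs - c *+ size rs.
Proof.
move=> sz n0 e; set n := size rs in sz n0 *.
have sumE (ts : seq K) : size ts = n -> \sum_(a <- ts) a ^+ n =
    - \sum_(j < n) (\prod_(a <- ts) ('X - a%:P))`_j * \sum_(a <- ts) a ^+ j.
  move=> st; apply/eqP; rewrite -addr_eq0; apply/eqP.
  under [X in _ + X]eq_bigr => j _ do rewrite mulr_sumr.
  rewrite exchange_big -big_split /= big1_seq // => a /andP[_ ats].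
  have: root (\prod_(a <- ts) ('X - a%:P)) a by rewrite root_prod_XsubC.
  rewrite rootE horner_coef size_prod_XsubC st big_ord_recr /= addrC.
  have /monicP := monic_prod_XsubC ts xpredT id.
  by rewrite /lead_coef size_prod_XsubC st /= => ->; rewrite mul1r => /eqP.
rewrite !sumE // e -opprD; congr (- _).
have [m nE] : exists m, n = m.+1 by exists n.-1; rewrite prednK.
have pE j : (j < n)%N -> \sum_(a <- ss) a ^+ j = \sum_(a <- rs) a ^+ j.
  by move=> jn; apply: power_sum_shift_lt e.
rewrite nE in sz n0 pE *; rewrite !big_ord_recl /= coefD coefC eqxx mulrDl.
rewrite pE // -addrA [in RHS]addrAC -addrA; congr (_ + _).
congr (_ + _).
  under eq_bigr do rewrite expr0.
  by rewrite big_const_seq count_predT iter_addr_0 -/n nE mulr_natr.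
by apply: eq_bigr => j _; rewrite coef_addC // pE // ltnS; exact: ltn_ord.
Qed.
End Newton.

(** * Formal logarithmic derivatives *)

Section LogDerivative.
Implicit Types (P Q : {poly algC}) (S c : nat -> algC).

(** Coefficientwise form of [u S' = C S] below degree M, where C is the sum of the [c_k u^k] with k
    > 0. The truncation lets polynomials play the role of power series. *)
Definition has_logderiv (M : nat) S c :=
  forall m, (m < M)%N -> m%:R * S m = \sum_(1 <= k < m.+1) c k * S (m - k)%N.

Lemma has_logderiv_polyE M P c (C := \poly_(k < M) (if k == 0%N then 0 else c k)) :
  has_logderiv M (nth 0 P) c <->
  (forall m, (m < M)%N -> ('X * P^`() - C * P)`_m = 0).
Proof.
have E m : (m < M)%N -> ('X * P^`() - C * P)`_m =
    m%:R * P`_m - \sum_(1 <= k < m.+1) c k * P`_(m - k).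
  move=> mM; rewrite coefB coefXM coefM; congr (_ - _).
    by case: m {mM} => [|m]; rewrite ?mul0r // coef_deriv mulr_natl.
  rewrite big_ord_recl /= coef_poly (leq_ltn_trans _ mM) // mul0r add0r.
  rewrite (big_addn 0 m.+1 1) subn1 big_mkord; apply: eq_bigr => j _.
  by rewrite /bump /= coef_poly add1n addn1 (leq_ltn_trans _ mM).
split=> H m mM; first by rewrite E // H // subrr.
by apply/eqP; rewrite -subr_eq0 -E // H.
Qed.

Lemma coefM_low0 M P Q : (forall m, (m < M)%N -> P`_m = 0) ->
  forall m, (m < M)%N -> (P * Q)`_m = 0.
Proof.
move=> H m mM; rewrite coefM big1 // => j _; rewrite H ?mul0r //.
by apply: leq_ltn_trans mM; rewrite -ltnS.
Qed.

(** By the product rule, the defect [X P' - C P] of a product is a combination of the defects of its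
    factors, and polynomials without terms below degree M form an ideal. *)
Lemma has_logderivM M P Q c c' :
  has_logderiv M (nth 0 P) c -> has_logderiv M (nth 0 Q) c' ->
  has_logderiv M (nth 0 (P * Q)) (fun k => c k + c' k).
Proof.
move=> /has_logderiv_polyE hP /has_logderiv_polyE hQ.
apply/has_logderiv_polyE => m mM.
have -> : \poly_(k < M) (if k == 0%N then 0 else c k + c' k) =
    \poly_(k < M) (if k == 0%N then 0 else c k) +
    \poly_(k < M) (if k == 0%N then 0 else c' k).
  apply/polyP => k; rewrite coefD !coef_poly.
  by case: (k < M)%N; case: (k == 0)%N; rewrite ?addr0.
rewrite derivM; set C := \poly_(k < M) (if k == 0%N then 0 else c k).
set C' := \poly_(k < M) (if k == 0%N then 0 else c' k).
have -> : 'X * (P^`() * Q + P * Q^`()) - (C + C') * (P * Q) =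
   ('X * P^`() - C * P) * Q + ('X * Q^`() - C' * Q) * P by ring.
by rewrite coefD !(@coefM_low0 M) ?addr0.
Qed.

Lemma has_logderiv_prod M n (P : 'I_n -> {poly algC}) (c : 'I_n -> nat -> algC) :
  (forall i, has_logderiv M (nth 0 (P i)) (c i)) ->
  has_logderiv M (nth 0 (\prod_(i < n) P i)) (fun k => \sum_(i < n) c i k).
Proof.
elim: n P c => [|n IH] P c H.
  move=> m _; rewrite big_ord0 big1 => [|k _]; last by rewrite big_ord0 mul0r.
  by rewrite coef1; case: m => [|m]; rewrite ?mul0r ?mulr0.
have HM := has_logderivM (IH _ _ (fun i => H (widen_ord (leqnSn n) i))) (H ord_max).
move=> m mM; rewrite big_ord_recr /= HM //.
by apply: eq_bigr => k _; rewrite big_ord_recr.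
Qed.

(** In characteristic zero m can be cancelled, so the recursion determines each coefficient from the
    earlier ones. *)
Lemma has_logderiv_uniq M S S' c c' :
  has_logderiv M S c -> has_logderiv M S' c' -> S 0%N = S' 0%N ->
  (forall k, (0 < k)%N -> c k = c' k) -> forall m, (m < M)%N -> S m = S' m.
Proof.
move=> hS hS' e0 ec; elim/ltn_ind => m IH mM.
case: m => // m in IH mM *.
have m0 : (m.+1%:R : algC) != 0 by rewrite pnatr_eq0.
apply: (mulfI m0); rewrite hS // hS' //; apply: eq_big_nat => k /andP[k0 km].
have lt : (m.+1 - k < m.+1)%N by rewrite ltn_subrL k0.
by rewrite ec // IH // (ltn_trans lt).
Qed.

Lemma coef_prod_linear n (g : 'I_n -> algC) :
  (\prod_(i < n) (1 + g i *: 'X : {poly algC}))`_n = \prod_(i < n) g i.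
Proof.
(* The degree bound is carried along so that the shorter product has no coefficient of degree n +
   1. *)
suff [] : (\prod_(i < n) (1 + g i *: 'X : {poly algC}))`_n = \prod_(i < n) g i /\
  (size (\prod_(i < n) (1 + g i *: 'X : {poly algC}))%R <= n.+1)%N by [].
elim: n g => [|n IH] g; first by rewrite !big_ord0 coef1 size_poly1.
have [e s] := IH (g \o widen_ord (leqnSn n)).
rewrite !big_ord_recr /= mulrDr mulr1 -scalerAr coefD coefZ coefMX /=.
rewrite nth_default ?add0r; last exact: s.
split; first by rewrite mulrC; congr (_ * _); exact: e.
rewrite (leq_trans (size_polyD _ _)) // geq_max (leq_trans s) //=.
rewrite (leq_trans (size_scale_leq _ _)) // (leq_trans (size_polyMleq _ _)) //.
by rewrite size_polyX addn2.
Qed.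

End LogDerivative.

Lemma is_mchar_chpow (F : finFieldType) (chi : F -> algC) k : is_mchar chi -> is_mchar (chpow chi k).
Proof.
case=> chi0 [chi1 chiM]; rewrite /chpow; split; first by rewrite eqxx.
split=> [|x y]; first by rewrite oner_eq0 chi1 expr1n.
rewrite mulf_eq0; case: eqP => [|_]; first by rewrite mul0r.
by case: eqP => [|_]; rewrite ?mulr0 // chiM exprMn.
Qed.

Lemma is_mchar_chmul (F : finFieldType) (chi rho : F -> algC) : is_mchar chi -> is_mchar rho ->
  is_mchar (chmul chi rho).
Proof.
case=> chi0 [chi1 chiM] [rho0 [rho1 rhoM]]; rewrite /chmul.
split; first by rewrite chi0 mul0r.
by split=> [|x y]; rewrite ?chi1 ?rho1 ?mulr1 // chiM rhoM mulrACA.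
Qed.

Lemma mcharX (F : finFieldType) (chi : F -> algC) x k : is_mchar chi -> chi (x ^+ k) = chi x ^+ k.
Proof. by case=> _ [c1 cM]; elim: k => // k IH; rewrite !exprS cM IH. Qed.

(** * Frobenius orbits in an algebraically closed extension *)

Section Closure.
Variables (F : finFieldType) (K : closedFieldType) (inF : {rmorphism F -> K}).

Definition frob (x : K) : K := x ^+ #|F|.

Fact pchar_nat_card : [pchar K].-nat #|F|.
Proof.
have [p pp cp] := finPcharP F.
have cK : p \in [pchar K] by exact: rmorph_pchar inF _ cp.
have /= := card_pprimeChar cp; rewrite -/(pPrimeCharType cp) => ->.
by rewrite pnatX (eq_pnat _ (pcharf_eq cK)) pnat_id ?orTb.
Qed.

Fact frob_zmod_morphism : zmod_morphism frob.
Proof.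
move=> x y; apply/(addIr (frob y)).
by rewrite subrK -exprDn_pchar ?pchar_nat_card // subrK.
Qed.

Fact frob_monoid_morphism : monoid_morphism frob.
Proof. by split=> [|x y]; rewrite /frob ?expr1n ?exprMn. Qed.

HB.instance Definition _ :=
  GRing.isZmodMorphism.Build K K frob frob_zmod_morphism.
HB.instance Definition _ :=
  GRing.isMonoidMorphism.Build K K frob frob_monoid_morphism.

Lemma frob_inj : injective frob.
Proof. exact: fmorph_inj. Qed.

Lemma frob_inF y : frob (inF y) = inF y.
Proof. by rewrite /frob -rmorphXn /= expf_card. Qed.

(** [X^q - X] already splits over F, with every element of F as a root, so its roots in K all come
    from F. *)
Lemma frob_fixedP x : frob x = x -> exists y, x = inF y.
Proof.
move=> fx; have: root (map_poly inF ('X^#|F| - 'X)) x.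
  by rewrite rmorphB /= map_polyXn map_polyX rootE !hornerE -/(frob x) fx subrr.
rewrite finField_genPoly -big_enum /= map_prod_XsubC.
rewrite -(big_map inF xpredT (fun z => 'X - z%:P)) root_prod_XsubC.
by case/mapP=> y _ ->; exists y.
Qed.

Definition descend (x : K) : F := odflt 0 [pick y | inF y == x].

Lemma inFK : cancel inF descend.
Proof.
move=> y; rewrite /descend; case: pickP => [z /eqP /fmorph_inj //|/(_ y)].
by rewrite eqxx.
Qed.

Lemma descendK x : frob x = x -> inF (descend x) = x.
Proof. by case/frob_fixedP=> y ->; rewrite inFK. Qed.

Lemma descend_polyK (p : {poly K}) :
  map_poly frob p = p -> map_poly inF (map_poly descend p) = p.
Proof.
move=> fp; have d0 : descend 0 = 0 by rewrite -(rmorph0 inF) inFK.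
apply/polyP => i; rewrite coef_map (coef_map_id0 _ _ d0) /= descendK //.
by rewrite -[in RHS]fp coef_map.
Qed.

(** For x in the extension of degree k this is its characteristic polynomial over F. The period k
    need not be minimal: if the orbit has length l, it is the minimal polynomial to the power k /
    l. *)
Definition orbit_poly (k : nat) (x : K) : {poly K} :=
  \prod_(a <- traject frob x k) ('X - a%:P).

(** Frobenius rotates the list of conjugates cyclically. *)
Lemma frob_orbit_poly k x : iter k frob x = x ->
  map_poly frob (orbit_poly k x) = orbit_poly k x.
Proof.
case: k => [|k] e; first by rewrite /orbit_poly big_nil rmorph1.
rewrite /orbit_poly map_prod_XsubC -(big_map frob xpredT (fun z => 'X - z%:P)).
rewrite [in LHS]trajectSr map_rcons -iterS e.
have -> : [seq frob i | i <- traject frob x k] = traject frob (frob x) k.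
  by elim: k {e} (x) => //= k IH y; rewrite IH.
by apply: perm_big; rewrite perm_rcons.
Qed.

Definition orbit_charpoly k x : {poly F} := map_poly descend (orbit_poly k x).

Lemma orbit_charpolyK k x : iter k frob x = x ->
  map_poly inF (orbit_charpoly k x) = orbit_poly k x.
Proof. by move/frob_orbit_poly/descend_polyK. Qed.

Lemma monic_orbit_charpoly k x : iter k frob x = x ->
  orbit_charpoly k x \is monic.
Proof.
by move=> e; rewrite -(map_monic inF) orbit_charpolyK // monic_prod_XsubC.
Qed.

Lemma size_orbit_charpoly k x : iter k frob x = x ->
  size (orbit_charpoly k x) = k.+1.
Proof.
move=> e; rewrite -(size_map_poly inF) orbit_charpolyK //.
by rewrite size_prod_XsubC size_traject.
Qed.

Lemma monic_split (f : {poly F}) : f \is monic ->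
  exists rs : seq K, map_poly inF f = \prod_(a <- rs) ('X - a%:P).
Proof.
move=> mf; have [rs ers] := closed_field_poly_normal (map_poly inF f).
by exists rs; rewrite ers (monicP _) ?map_monic // scale1r.
Qed.

Lemma perm_frob_roots (f : {poly F}) rs :
  map_poly inF f = \prod_(a <- rs) ('X - a%:P) -> perm_eq (map frob rs) rs.
Proof.
move=> e; have: map_poly frob (map_poly inF f) = map_poly inF f.
  by apply/polyP=> i; rewrite !coef_map /= frob_inF.
rewrite e map_prod_XsubC -(big_map frob xpredT (fun z => 'X - z%:P)).
exact: prod_XsubC_eq.
Qed.

Lemma count_roots_frob (f : {poly F}) rs x :
  map_poly inF f = \prod_(a <- rs) ('X - a%:P) ->
  count_mem (frob x) rs = count_mem x rs.
Proof.
move/perm_frob_roots/seq.permP <-; rewrite count_map; apply: eq_count => y /=.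
by rewrite (inj_eq frob_inj).
Qed.

(** Let l be the orbit length of x and a its multiplicity in f. All conjugates of x have
    multiplicity a, so the admissible k are the j l with 0 < j <= a. *)
Lemma count_periods (f : {poly F}) rs m x :
  map_poly inF f = \prod_(a <- rs) ('X - a%:P) -> size rs = m -> x \in rs ->
  (\sum_(1 <= k < m.+1)
     ((iter k frob x == x) && (orbit_poly k x %| map_poly inF f)%R) =
   count_mem x rs)%N.
Proof.
move=> e sm xrs.
have ci i : count_mem (iter i frob x) rs = count_mem x rs.
  by elim: i => // i <-; rewrite iterS (count_roots_frob _ e).
have [l l0 [el lmin]] : exists2 l, (0 < l)%N & iter l frob x = x /\
    forall j, (0 < j < l)%N -> iter j frob x <> x.
  have ex : exists l, (0 < l)%N && (iter l frob x == x).
    (* Pigeonhole: m + 1 iterates of x lie among the m entries of [rs]. *)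
    have: ~~ uniq (traject frob x m.+1).
      apply/negP => u; suff /(uniq_leq_size u) : {subset traject frob x m.+1 <= rs}.
        by rewrite size_traject sm ltnn.
      move=> y /trajectP[i _ ->].
      by rewrite -has_pred1 has_count ci -has_count has_pred1.
    case/(traject_inj_period frob_inj) => l /andP[l0 _] el.
    by exists l; rewrite l0 el eqxx.
  case: (ex_minnP ex) => l /andP[l0 /eqP el] lmin; exists l => //; split=> // j.
  case/andP=> j0 jl ej; have := lmin j; rewrite j0 ej eqxx => /(_ isT).
  by rewrite leqNgt jl.
have ul := uniq_traject_minimal frob_inj lmin.
have dvE j : (orbit_poly (j * l) x %| map_poly inF f) = (j <= count_mem x rs)%N.
  rewrite e; apply/idP/idP => [/dvdp_prod_XsubC_count /(_ x) | le_j].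
    rewrite count_traject_mul // (count_uniq_mem _ ul).
    by case: l l0 {el lmin ul} => // l _; rewrite mem_head muln1.
  apply/dvdp_prod_XsubC_count => y; rewrite count_traject_mul //.
  rewrite (count_uniq_mem _ ul); case: trajectP => [[i _ ->]|_].
    by rewrite ci muln1.
  by rewrite muln0.
rewrite -[RHS](@sum_multiples_bounded l _ m) //.
  apply: eq_bigr => k _; rewrite (iter_period_dvdn _ l0 el lmin).
  by case: dvdnP => // -[j ->]; rewrite dvE mulnK.
(* The bound a l <= m holds because the orbit polynomial of length a l divides f, which has degree
   m. *)
have := dvdp_leq _ (_ : orbit_poly (count_mem x rs * l) x %| map_poly inF f).
rewrite dvE leqnn e => /(_ (monic_neq0 (monic_prod_XsubC _ _ _)) isT).
by rewrite !size_prod_XsubC size_traject sm.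
Qed.

Lemma iter_frob k x : iter k frob x = x ^+ (#|F| ^ k).
Proof. by elim: k => //= k ->; rewrite /frob -exprM expnSr. Qed.

(** The subfield of K of degree k over F. [undup] gives distinctness without an appeal to
    separability. At k = 0 the polynomial is zero, whence [0 < k] in [mem_fixpts]. *)
Definition fixpts (k : nat) : seq K :=
  undup (sval (closed_field_poly_normal ('X^(#|F| ^ k) - 'X : {poly K}))).

Lemma fixpts_uniq k : uniq (fixpts k).
Proof. exact: undup_uniq. Qed.

Lemma mem_fixpts k x : (0 < k)%N -> (x \in fixpts k) = (iter k frob x == x).
Proof.
move=> k0; rewrite mem_undup; case: closed_field_poly_normal => rs /= e.
have q1 : (1 < #|F| ^ k)%N.
  by rewrite -(exp1n k) ltn_exp2r // finNzRing_gt1.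
have nz : 'X^(#|F| ^ k) - 'X != 0 :> {poly K}.
  by rewrite -size_poly_eq0 size_polyDl size_polyXn // size_polyN size_polyX.
have lnz : lead_coef ('X^(#|F| ^ k) - 'X : {poly K}) != 0 by rewrite lead_coef_eq0.
by rewrite -root_prod_XsubC -(rootZ _ _ lnz) -e rootE !hornerE subr_eq0 iter_frob.
Qed.

(** * Sums over monic polynomials *)

Definition monics (m : nat) : seq {poly F} :=
  [seq 'X^m + rVpoly v | v <- enum {: 'rV[F]_m}].

Lemma monics_uniq m : uniq (monics m).
Proof.
rewrite map_inj_uniq ?enum_uniq // => u v /addrI e.
by rewrite -(rVpolyK u) e rVpolyK.
Qed.

Lemma mem_monics m f : (f \in monics m) = (f \is monic) && (size f == m.+1).
Proof.
apply/mapP/andP => [[v _ ->]|[mf /eqP sf]].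
  have lt : (size (rVpoly v) < size ('X^m : {poly F}))%N.
    by rewrite size_polyXn ltnS size_poly.
  by rewrite monicE lead_coefDl // lead_coefXn size_polyDl // size_polyXn !eqxx.
exists (poly_rV (f - 'X^m)); first by rewrite mem_enum.
rewrite poly_rV_K; first by rewrite addrC subrK.
apply/leq_sizeP => j; rewrite leq_eqVlt coefB coefXn.
case/orP=> [/eqP <-|mj].
  by move/monicP: mf; rewrite /lead_coef sf /= => ->; rewrite eqxx subrr.
by rewrite nth_default ?sf // gtn_eqF // subrr.
Qed.

(** An injective self-map of a finite list without repetition permutes it. It is applied to
    translations by a polynomial of lower degree. *)
Lemma big_monics_perm m (P : pred {poly F}) (G : {poly F} -> algC) h :
  injective h -> {homo h : f / f \in monics m} ->
  \sum_(f <- monics m | P (h f)) G (h f) = \sum_(f <- monics m | P f) G f.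
Proof.
move=> hi hm; rewrite -(big_map h P G); apply: perm_big.
have um : uniq (map h (monics m)) by rewrite map_inj_uniq ?monics_uniq.
apply: uniq_perm; rewrite ?monics_uniq //.
have sub : {subset map h (monics m) <= monics m}.
  by move=> f /mapP[g gm ->]; apply: hm.
by move=> f; apply: (uniq_min_size um sub _).2; rewrite size_map.
Qed.

Lemma big_monics_mul m k (g : {poly F}) (G : {poly F} -> algC) :
  (k <= m)%N -> g \in monics k ->
  \sum_(h <- monics (m - k)) G (g * h) = \sum_(f <- monics m | g %| f) G f.
Proof.
move=> km; rewrite mem_monics => /andP[mg /eqP sg].
have gn0 := monic_neq0 mg.
rewrite -[RHS]big_filter -(big_map ( *%R g) xpredT G); apply: perm_big.
apply: uniq_perm; rewrite ?filter_uniq ?monics_uniq //.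
  by rewrite map_inj_uniq ?monics_uniq //; exact: mulfI.
move=> f; rewrite mem_filter mem_monics; apply/mapP/andP.
  case=> h; rewrite mem_monics => /andP[mh /eqP sh] ->.
  rewrite dvdp_mulr // monicMl // mh size_monicM ?monic_neq0 // sg sh.
  by rewrite addSn /= addnS subnKC.
case=> /dvdpP[h ->] /andP[]; rewrite mulrC => mgh sgh.
have mh : h \is monic by rewrite -(monicMl h mg).
exists h => //; rewrite mem_monics mh /=; move: sgh.
rewrite size_monicM ?monic_neq0 // sg addSn /= => /eqP e.
by rewrite -(eqn_add2l k) e addnS subnKC.
Qed.

(** The analogue of summing the von Mangoldt function over divisors: each distinct root is counted
    with its multiplicity, and the multiplicities add up to the degree. No factorization into
    irreducibles is required. *)
Lemma count_orbit_divisors m f : f \in monics m ->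
  (\sum_(1 <= k < m.+1) \sum_(x <- fixpts k) (orbit_charpoly k x %| f)%R = m)%N.
Proof.
rewrite mem_monics => /andP[mf /eqP sf]; have [rs ers] := monic_split mf.
have srs : size rs = m.
  by apply: succn_inj; rewrite -sf -(size_map_poly inF) ers size_prod_XsubC.
(* For k > 0, x is itself a root of [orbit_poly k x], so only roots of f contribute. *)
transitivity (\sum_(1 <= k < m.+1) \sum_(x <- undup rs)
    ((iter k frob x == x) && (orbit_poly k x %| map_poly inF f)%R))%N.
  apply: eq_big_nat => k /andP[k0 _].
  rewrite -[LHS]big_mkcond -[RHS]big_mkcond -[LHS]big_filter -[RHS]big_filter /=.
  apply: perm_big; apply: uniq_perm; rewrite ?filter_uniq ?undup_uniq //.
  move=> x; rewrite !mem_filter mem_fixpts // mem_undup.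
  case: eqP => [ex|_]; last by rewrite /= andbF.
  rewrite -(dvdp_map inF) orbit_charpolyK // andbT /=.
  case: (boolP (x \in rs)); rewrite ?andbT ?andbF //.
  apply: contraNF => dv; rewrite -root_prod_XsubC -ers.
  apply: (root_dvdp dv); rewrite root_prod_XsubC.
  by case: (k) k0 => // ? _; rewrite mem_head.
rewrite exchange_big /= (eq_big_seq (fun x => count_mem x rs)); last first.
  by move=> x; rewrite mem_undup => /(count_periods ers srs).
rewrite -[RHS]srs -(perm_size (perm_count_undup rs)) size_flatten /shape.
rewrite sumnE !big_map; apply: eq_bigr => x _; by rewrite size_nseq.
Qed.

Definition monic_sum (Lam : {poly F} -> algC) m := \sum_(f <- monics m) Lam f.

Definition point_sum (Lam : {poly F} -> algC) k :=
  \sum_(x <- fixpts k) Lam (orbit_charpoly k x).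

(* The logarithmic derivative of the Euler product of an L-series, with prime
   powers replaced by the points of the finite extensions. *)
Lemma monic_sum_rec (Lam : {poly F} -> algC) m :
  (forall f g, f \is monic -> g \is monic -> Lam (f * g) = Lam f * Lam g) ->
  m%:R * monic_sum Lam m =
  \sum_(1 <= k < m.+1) point_sum Lam k * monic_sum Lam (m - k).
Proof.
move=> LamM.
transitivity (\sum_(1 <= k < m.+1) \sum_(x <- fixpts k)
    \sum_(f <- monics m | orbit_charpoly k x %| f) Lam f); last first.
  apply: eq_big_nat => k /andP[k0 km]; rewrite mulr_suml.
  apply: eq_big_seq => x; rewrite mem_fixpts // => /eqP ex.
  have mo := monic_orbit_charpoly ex.
  rewrite -(big_monics_mul (k := k)) //; last first.
    by rewrite mem_monics mo size_orbit_charpoly /=.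
  rewrite mulr_sumr; apply: eq_big_seq => h.
  by rewrite mem_monics => /andP[mh _]; rewrite LamM.
rewrite mulr_sumr.
under [RHS]eq_bigr => k _ do under eq_bigr => x _ do rewrite big_mkcond.
under [RHS]eq_bigr => k _ do rewrite exchange_big.
rewrite exchange_big /=; apply: eq_big_seq => f fm.
rewrite -{1}(count_orbit_divisors fm) natr_sum mulr_suml.
apply: eq_bigr => k _; rewrite natr_sum mulr_suml; apply: eq_bigr => x _.
by case: (_ %| _); rewrite ?mul1r ?mul0r.
Qed.

(** * Power sums, norms and traces *)

Definition roots_of (f : {poly F}) : seq K :=
  sval (closed_field_poly_normal (map_poly inF f)).

Lemma roots_ofE f : f \is monic ->
  map_poly inF f = \prod_(a <- roots_of f) ('X - a%:P).
Proof.
rewrite /roots_of; case: closed_field_poly_normal => rs /= e mf.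
by rewrite e (monicP _) ?map_monic // scale1r.
Qed.

Lemma size_roots_of f : f \is monic -> size (roots_of f) = (size f).-1.
Proof.
by move=> mf; rewrite -(size_map_poly inF) roots_ofE // size_prod_XsubC.
Qed.

Lemma perm_roots_of f rs : f \is monic ->
  map_poly inF f = \prod_(a <- rs) ('X - a%:P) -> perm_eq (roots_of f) rs.
Proof. by move=> mf; rewrite roots_ofE // => /prod_XsubC_eq. Qed.

Lemma roots_ofM f g : f \is monic -> g \is monic ->
  perm_eq (roots_of (f * g)) (roots_of f ++ roots_of g).
Proof.
move=> mf mg; apply: perm_roots_of; first by rewrite monicMl.
by rewrite rmorphM /= !roots_ofE // big_cat.
Qed.

Definition power_sum (d : nat) (f : {poly F}) : F :=
  descend (\sum_(r <- roots_of f) r ^+ d).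

Lemma power_sumE d f : f \is monic ->
  inF (power_sum d f) = \sum_(r <- roots_of f) r ^+ d.
Proof.
move=> mf; apply: descendK; rewrite rmorph_sum /=.
rewrite -[RHS](perm_big _ (perm_frob_roots (roots_ofE mf))) big_map.
by apply: eq_bigr => r _; rewrite rmorphXn.
Qed.

Lemma power_sumM d f g : f \is monic -> g \is monic ->
  power_sum d (f * g) = power_sum d f + power_sum d g.
Proof.
move=> mf mg; apply: (fmorph_inj inF).
rewrite rmorphD /= !power_sumE // ?monicMl //.
by rewrite (perm_big _ (roots_ofM mf mg)) big_cat.
Qed.

(** Expressed by the constant term, so that the effect of adding a constant to f can be read off. *)
Definition root_prod (f : {poly F}) : F := (-1) ^+ (size f).-1 * f`_0.

Lemma root_prodE f : f \is monic ->
  inF (root_prod f) = \prod_(r <- roots_of f) r.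
Proof.
move=> mf; rewrite rmorphM rmorphXn rmorphN1 /= -coef_map roots_ofE //.
by rewrite coef0_prod_XsubC size_roots_of // signrMK.
Qed.

Lemma root_prodM f g : f \is monic -> g \is monic ->
  root_prod (f * g) = root_prod f * root_prod g.
Proof.
move=> mf mg; apply: (fmorph_inj inF).
rewrite [RHS]rmorphM /= !root_prodE // ?monicMl //.
by rewrite (perm_big _ (roots_ofM mf mg)) big_cat.
Qed.

Lemma power_sum_addC f c : f \is monic -> (1 < size f)%N ->
  power_sum (size f).-1 (f + c%:P) =
  power_sum (size f).-1 f - c *+ (size f).-1.
Proof.
move=> mf sf; have sfc : size (f + c%:P) = size f.
  by rewrite size_polyDl // (leq_ltn_trans (size_polyC_leq1 c)).
have mfc : f + c%:P \is monic.
  by rewrite monicE lead_coefDl ?(monicP mf) // (leq_ltn_trans (size_polyC_leq1 c)).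
apply: (fmorph_inj inF); rewrite rmorphB rmorphMn /= !power_sumE //.
rewrite -(size_roots_of mf); apply: power_sum_shift.
- by rewrite !size_roots_of // sfc.
- by rewrite size_roots_of // -ltnS prednK // ltnW.
- by rewrite -!roots_ofE // rmorphD /= map_polyC.
Qed.

Lemma power_sum1 f : f \is monic -> (1 < size f)%N ->
  power_sum 1 f = - f`_(size f).-2.
Proof.
move=> mf sf; apply: (fmorph_inj inF); rewrite power_sumE // rmorphN /=.
rewrite -coef_map roots_ofE // -size_roots_of // coefPn_prod_XsubC ?opprK //.
by rewrite size_roots_of //; case: (size f) sf => [|[]].
Qed.

Definition ext_norm (k : nat) (x : K) : F :=
  descend (\prod_(a <- traject frob x k) a).
Definition ext_trace (k : nat) (x : K) : F :=
  descend (\sum_(a <- traject frob x k) a).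

Lemma perm_roots_orbit k x : iter k frob x = x ->
  perm_eq (roots_of (orbit_charpoly k x)) (traject frob x k).
Proof.
by move=> e; apply: perm_roots_of; rewrite ?orbit_charpolyK ?monic_orbit_charpoly.
Qed.

Lemma ext_normE k x : iter k frob x = x ->
  inF (ext_norm k x) = x ^+ (\sum_(i < k) #|F| ^ i).
Proof.
move=> e; have -> : ext_norm k x = root_prod (orbit_charpoly k x).
  apply: (fmorph_inj inF); rewrite root_prodE ?monic_orbit_charpoly //.
  rewrite (perm_big _ (perm_roots_orbit e)) descendK //.
  rewrite rmorph_prod; have := frob_orbit_poly e.
  rewrite map_prod_XsubC -(big_map frob xpredT (fun z => 'X - z%:P)).
  by move/prod_XsubC_eq => pe; rewrite -[RHS](perm_big _ pe) big_map.
rewrite root_prodE ?monic_orbit_charpoly // (perm_big _ (perm_roots_orbit e)).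
elim: k {e} => [|k IH]; first by rewrite big_nil big_ord0.
by rewrite trajectSr -cats1 big_cat big_seq1 IH /= big_ord_recr exprD iter_frob.
Qed.

Lemma root_prod_orbit k x : iter k frob x = x ->
  root_prod (orbit_charpoly k x) = ext_norm k x.
Proof.
move=> e; rewrite /ext_norm -(perm_big _ (perm_roots_orbit e)) /=.
by rewrite -root_prodE ?monic_orbit_charpoly // inFK.
Qed.

Lemma power_sum_orbit d k x : iter k frob x = x ->
  power_sum d (orbit_charpoly k x) = ext_trace k (x ^+ d).
Proof.
move=> e; rewrite /power_sum (perm_big _ (perm_roots_orbit e)) /=.
congr descend; elim: k {e} x => [|k IH] x; first by rewrite !big_nil.
by rewrite /= !big_cons IH rmorphXn.
Qed.

Lemma iter_frobX k x d : iter k frob x = x -> iter k frob (x ^+ d) = x ^+ d.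
Proof. by rewrite !iter_frob -exprM mulnC exprM => ->. Qed.

Lemma ext_normX k x d : iter k frob x = x ->
  ext_norm k (x ^+ d) = ext_norm k x ^+ d.
Proof.
move=> e; apply: (fmorph_inj inF); rewrite rmorphXn /= !ext_normE //.
  by rewrite -!exprM mulnC.
exact: iter_frobX.
Qed.

(** * L-series over monic polynomials *)

Section Characters.
Variable psi : F -> algC.
Hypotheses (psi0 : psi 0 = 1) (psiD : forall x y, psi (x + y) = psi x * psi y).
Hypothesis psi_sum : \sum_x psi x = 0.

Definition gsum (chi : F -> algC) : algC := \sum_x chi x * psi x.

Definition Lchar (chi : F -> algC) (d : nat) (f : {poly F}) : algC :=
  chi (root_prod f) * psi (power_sum d f).

Lemma LcharM chi d f g : is_mchar chi -> f \is monic -> g \is monic ->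
  Lchar chi d (f * g) = Lchar chi d f * Lchar chi d g.
Proof.
move=> [_ [_ chiM]] mf mg.
by rewrite /Lchar root_prodM // power_sumM // chiM psiD mulrACA.
Qed.

Lemma Lchar_logderiv M chi d : is_mchar chi ->
  has_logderiv M (monic_sum (Lchar chi d)) (point_sum (Lchar chi d)).
Proof. by move=> hchi m _; apply: monic_sum_rec => f g; apply: LcharM. Qed.

Lemma monic_sum_Lchar0 chi d : is_mchar chi -> monic_sum (Lchar chi d) 0 = 1.
Proof.
move=> [_ [chi1 _]]; rewrite /monic_sum (perm_big [:: 1%R]).
  rewrite big_seq1 /Lchar /root_prod size_poly1 coef1 mul1r chi1 mul1r.
  have := size_roots_of (monic1 F); rewrite size_poly1 /power_sum.
  by case: (roots_of 1) => // _; rewrite big_nil -(rmorph0 inF) inFK.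
apply: uniq_perm; rewrite ?monics_uniq // => f; rewrite mem_monics inE.
apply/andP/eqP => [[mf /eqP sf]|->]; last by rewrite monic1 size_poly1.
move/monicP: mf; have /eqP/size_poly1P[c _ ->] := sf.
by rewrite lead_coefC => ->.
Qed.

Lemma monic_sum_Lchar1 chi : monic_sum (Lchar chi 1) 1 = gsum chi.
Proof.
rewrite /monic_sum (perm_big [seq 'X - a%:P | a <- enum F]).
  rewrite big_map big_enum; apply: eq_bigr => a _; rewrite /Lchar.
  rewrite power_sum1 ?monicXsubC ?size_XsubC // /root_prod size_XsubC /=.
  by rewrite coefB coefX coefC /= sub0r mulrNN mul1r opprK.
apply: uniq_perm; rewrite ?monics_uniq //.
  rewrite map_inj_uniq ?enum_uniq // => a b /addrI/oppr_inj.
  exact: polyC_inj.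
move=> f; rewrite mem_monics; apply/andP/mapP => [[mf /eqP sf]|[a _ ->]].
  exists (- f`_0); first by rewrite mem_enum.
  apply/polyP => -[|[|i]]; rewrite coefB coefX coefC /=.
  - by rewrite sub0r opprK.
  - by rewrite subr0; move/monicP: mf; rewrite /lead_coef sf.
  - by rewrite subr0 nth_default ?sf.
by rewrite monicXsubC size_XsubC.
Qed.

Lemma psi_nontrivial : exists x, psi x != 1.
Proof.
apply/existsP; apply: contraT; rewrite negb_exists => /forallP H.
have := psi_sum; rewrite (eq_bigr (fun _ => 1)) => [|x _].
  rewrite sumr_const => /eqP; rewrite pnatr_eq0 => /eqP c0.
  by have := card0_eq c0 0.
by have := H x; rewrite negbK => /eqP.
Qed.

Lemma monic_addl m f (h : {poly F}) : f \in monics m -> (size h <= m)%N ->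
  f + h \in monics m.
Proof.
rewrite !mem_monics => /andP[mf /eqP sf] sh.
have lt : (size h < size f)%N by rewrite sf.
by rewrite monicE lead_coefDl // size_polyDl // sf -monicE mf eqxx.
Qed.

(** In degree at least 2 the coefficient of [X^(m-1)], minus the sum of the roots, is not the
    constant term. Translating it by -c fixes the product of the roots and multiplies the sum by
    [psi c], which differs from 1. *)
Lemma monic_sum_Lchar_ge2 chi m : (1 < m)%N -> monic_sum (Lchar chi 1) m = 0.
Proof.
move=> m1; have [c c1] := psi_nontrivial.
pose h : {poly F} := (- c) *: 'X^(m.-1).
have sh : (size h <= m)%N.
  by rewrite (leq_trans (size_scale_leq _ _)) // size_polyXn prednK // ltnW.
have /eqP : monic_sum (Lchar chi 1) m = psi c * monic_sum (Lchar chi 1) m.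
  rewrite {1}/monic_sum -(@big_monics_perm m xpredT _ (fun f => f + h)) //.
  - rewrite mulr_sumr; apply: eq_big_seq => f fm.
    have := monic_addl fm sh; move: (fm); rewrite !mem_monics.
    case/andP=> mf /eqP sf /andP[mg /eqP sg]; rewrite /Lchar.
    have m2 : (1 < m.+1)%N by rewrite ltnS ltnW.
    rewrite !power_sum1 ?sf ?sg //=; rewrite coefD opprD coefZ coefXn eqxx mulr1 opprK.
    rewrite psiD /root_prod sf sg coefD coefZ coefXn.
    have -> : (0 == m.-1)%N = false by case: (m) m1 => [|[]].
    by rewrite mulr0 addr0; ring.
  - exact: addIr.
  - by move=> f fm; apply: monic_addl.
rewrite -subr_eq0 -{1}[monic_sum _ _]mul1r -mulrBl mulf_eq0 subr_eq0.
by rewrite eq_sym (negPf c1) => /eqP.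
Qed.

Definition hd_const (d : nat) : algC :=
  \sum_(f <- monics d | f`_0 == 0) psi (power_sum d f).

Lemma monic_sum_Lchar_top chi d : (0 < d)%N ->
  monic_sum (Lchar chi d) d =
  hd_const d * \sum_c chi ((-1) ^+ d * c) * psi (- (c *+ d)).
Proof.
move=> d0; rewrite /monic_sum (partition_big (fun f : {poly F} => f`_0) xpredT) //=.
rewrite mulr_sumr; apply: eq_bigr => c _.
rewrite -(@big_monics_perm d (fun f => f`_0 == c) _ (fun f => f + c%:P)).
- rewrite (eq_bigl (fun f : {poly F} => f`_0 == 0)) => [|f]; last first.
    by rewrite coefD coefC /= -subr_eq0 addrK.
  rewrite mulr_suml [LHS]big_seq_cond [RHS]big_seq_cond; apply: eq_bigr => f /andP[fm /eqP f0].
  have /andP[mf /eqP sf] : (f \is monic) && (size f == d.+1) by rewrite -mem_monics.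
  have sc : (size (c%:P : {poly F}) <= d)%N by apply: leq_trans (size_polyC_leq1 c) _.
  have := monic_addl fm sc; rewrite mem_monics => /andP[mg /eqP sg].
  have := power_sum_addC c mf; rewrite sf /Lchar => -> //.
  rewrite psiD /root_prod sg coefD f0 coefC eqxx add0r /=; ring.
- exact: addIr.
- by move=> f fm; apply: monic_addl => //; apply: leq_trans (size_polyC_leq1 c) _.
Qed.

(** * Grouping the points of the extensions by their d-th powers *)

Section Multiplication.
Variables (d : nat) (chi rho : F -> algC).
Hypotheses (d0 : (0 < d)%N) (dvd_d : (d %| #|F|.-1)%N).
Hypotheses (hchi : is_mchar chi) (hrho : is_mchar rho).
Hypothesis rho_sum : forall z, z != 0 ->
  \sum_(i < d) rho z ^+ i = if z ^+ (#|F|.-1 %/ d) == 1 then d%:R else 0.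
Variable w : F.
Hypothesis prim_w : d.-primitive_root w.

(** A nonzero y is a d-th power in the extension of degree k when [y^((q^k-1)/d) = 1]. That exponent
    is (q^k-1)/(q-1) times (q-1)/d, so this is a condition on the norm of y, detected by rho. The
    d-th roots then differ by powers of [w], which lies in F. *)
Lemma count_powers k y : (0 < k)%N -> y \in fixpts k -> y != 0 ->
  (count (fun x => x ^+ d == y) (fixpts k))%:R =
  \sum_(i < d) rho (ext_norm k y) ^+ i.
Proof.
move=> k0; rewrite mem_fixpts // => /eqP ey y0.
have q0 : (0 < #|F|)%N by apply/card_gt0P; exists 0.
have fixE x : x != 0 -> (x \in fixpts k) = (x ^+ (#|F| ^ k).-1 == 1).
  move=> x0; rewrite mem_fixpts // iter_frob -[X in _ ^+ X]prednK ?expn_gt0 ?q0 //.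
  by rewrite exprS -{3}[x]mulr1 (inj_eq (mulfI x0)).
have powE x : x ^+ d = y -> x != 0 ->
    (x \in fixpts k) = (ext_norm k y ^+ (#|F|.-1 %/ d) == 1).
  move=> xy x0; rewrite fixE // -(inj_eq (fmorph_inj inF)) rmorphXn /= ext_normE //.
  rewrite rmorph1 -xy -!exprM mulnAC muln_divA // [(d * _)%N]mulnC mulnK //.
  by rewrite -predn_exp.
have nn0 : ext_norm k y != 0.
  by rewrite -(fmorph_eq0 inF) ext_normE // expf_neq0.
rewrite rho_sum //.
have xn0 x : x ^+ d = y -> x != 0.
  by move=> xy; apply: contraNneq y0 => x0; rewrite -xy x0 expr0n gtn_eqF.
case: ifP => cond; last first.
  rewrite -size_filter (_ : filter _ _ = [::]) //; apply/eqP.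
  rewrite -[_ == _]negbK -has_filter; apply/hasPn => x xf.
  by apply/negP => /eqP xy; rewrite (powE _ xy (xn0 _ xy)) cond in xf.
have [x0 /eqP] : exists x0 : K, root ('X^d - y%:P) x0.
  by apply/closed_rootP; rewrite size_XnsubC // eqSS gtn_eqF.
rewrite !hornerE => /eqP; rewrite subr_eq0 => /eqP x0y.
congr _%:R; rewrite -size_filter.
have pK : d.-primitive_root (inF w) by rewrite fmorph_primitive_root.
have pe : perm_eq [seq x <- fixpts k | x ^+ d == y]
                  [seq x0 * inF w ^+ (i : 'I_d) | i : 'I_d].
  apply: uniq_perm; first by rewrite filter_uniq ?fixpts_uniq.
    rewrite map_inj_uniq ?enum_uniq // => i j /(mulfI (xn0 _ x0y)) /eqP.
    by rewrite (eq_prim_root_expr pK) !modn_small ?ltn_ord // => /eqP/val_inj.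
  move=> x; rewrite mem_filter; apply/andP/mapP => [[/eqP xy _]|[i _ ->]].
    have [|i ei] := prim_rootP pK (_ : (x / x0) ^+ d = 1).
      by rewrite expr_div_n xy x0y divff.
    by exists i; rewrite ?mem_enum // -ei mulrC divfK // xn0.
  have xy : (x0 * inF w ^+ i) ^+ d = y.
    by rewrite exprMn x0y exprAC (prim_expr_order pK) expr1n mulr1.
  by rewrite xy eqxx (powE _ xy (xn0 _ xy)) cond.
by rewrite (perm_size pe) size_map -cardE card_ord.
Qed.

(** The d-th power of the norm of x is the norm of [x ^+ d], and the d-th power sum of its
    conjugates is the trace of [x ^+ d]. The summand on the right thus depends on x only through
    [x ^+ d]. *)
Lemma point_sum_mult k : (0 < k)%N ->
  \sum_(i < d) point_sum (Lchar (chmul chi (chpow rho i)) 1) k =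
  point_sum (Lchar (chpow chi d) d) k.
Proof.
move=> k0; pose H y := chi (ext_norm k y) * psi (ext_trace k y).
have -> : point_sum (Lchar (chpow chi d) d) k = \sum_(x <- fixpts k) H (x ^+ d).
  apply: eq_big_seq => x; rewrite mem_fixpts // => /eqP ex.
  rewrite /Lchar root_prod_orbit // power_sum_orbit // /H ext_normX // mcharX //.
  rewrite /chpow; case: eqP => // ->; rewrite (proj1 hchi).
  by rewrite expr0n gtn_eqF.
have -> : \sum_(x <- fixpts k) H (x ^+ d) =
    \sum_(y <- fixpts k) H y * (count (fun x => x ^+ d == y) (fixpts k))%:R.
  under [RHS]eq_bigr => y _ do rewrite -sum1_count natr_sum mulr_sumr big_mkcond.
  rewrite exchange_big; apply: eq_big_seq => x xf /=.
  have xdf : x ^+ d \in fixpts k.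
    by move: xf; rewrite !mem_fixpts // => /eqP/iter_frobX ->.
  rewrite -big_mkcond (big_rem _ xdf) /= eqxx mulr1 big1_seq ?addr0 // => y.
  case/andP=> /eqP <-; rewrite mem_rem_uniq ?fixpts_uniq // inE eqxx //.
rewrite exchange_big; apply: eq_big_seq => y yf /=.
have ey : iter k frob y = y by apply/eqP; rewrite -mem_fixpts.
under eq_bigr => i _.
  rewrite /Lchar root_prod_orbit // power_sum_orbit // expr1 /chmul.
  rewrite mulrAC -/(H y); over.
rewrite -mulr_sumr; have [ny0|nyn0] := eqVneq (ext_norm k y) 0.
  by rewrite /H ny0 (proj1 hchi) !mul0r.
rewrite count_powers //; first by congr (_ * _); apply: eq_bigr => i _;
  rewrite /chpow (negPf nyn0).
apply: contraNneq nyn0 => y0; rewrite -(fmorph_eq0 inF) ext_normE // y0.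
by case: (k) k0 => // k' _; rewrite big_ord_recl expn0 exprD expr1 mul0r.
Qed.

(* Both sides are the top coefficient of the L-series of the character
   [chi (root_prod f) ^ d * psi (power_sum d f)], which factors as
   [\prod_i (1 + gsum (chi rho^i) t)] after the base change [t = u ^ d]. *)
Lemma prod_gsum : \prod_(i < d) gsum (chmul chi (chpow rho i)) =
  hd_const d * \sum_c chpow chi d ((-1) ^+ d * c) * psi (- (c *+ d)).
Proof.
rewrite -monic_sum_Lchar_top // -coef_prod_linear.
pose c (i : 'I_d) := point_sum (Lchar (chmul chi (chpow rho i)) 1).
have hi (i : 'I_d) := is_mchar_chmul hchi (is_mchar_chpow i hrho).
apply: (@has_logderiv_uniq d.+1 _ _ (fun k => \sum_i c i k)
          (point_sum (Lchar (chpow chi d) d))) => //.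
- apply: has_logderiv_prod => i m mM.
  have E j : (1 + gsum (chmul chi (chpow rho i)) *: 'X : {poly algC})`_j =
      monic_sum (Lchar (chmul chi (chpow rho i)) 1) j.
    rewrite coefD coef1 coefZ coefX; case: j => [|[|j]].
    + by rewrite monic_sum_Lchar0 // mulr0 addr0.
    + by rewrite monic_sum_Lchar1 mulr1 add0r.
    + by rewrite monic_sum_Lchar_ge2 // mulr0 addr0.
  rewrite E (Lchar_logderiv _ (hi i) mM); apply: eq_bigr => k _.
  by rewrite E.
- exact: Lchar_logderiv (is_mchar_chpow _ hchi).
- rewrite monic_sum_Lchar0 ?is_mchar_chpow //; last exact: is_mchar_chpow.
  rewrite -horner_coef0 horner_prod big1 // => i _.
  by rewrite !hornerE ?mulr0 ?addr0.
- exact: point_sum_mult.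
Qed.
End Multiplication.
End Characters.
End Closure.

(** * Multiplicative characters *)

Lemma sum_unity_root (u : algC) n : u ^+ n = 1 ->
  \sum_(i < n) u ^+ i = if u == 1 then n%:R else 0.
Proof.
move=> un; case: eqP => [->|/eqP u1].
  under eq_bigr do rewrite expr1n.
  by rewrite sumr_const card_ord.
have /eqP := subrX1 u n; rewrite un subrr eq_sym mulf_eq0 subr_eq0.
by rewrite (negPf u1) => /eqP.
Qed.

Section Generator.
Variables (F : finFieldType) (T : F -> algC).
Hypothesis hT : is_char_generator T.
Local Notation N := (#|F|.-1).
Let hT1 : is_mchar T := proj1 hT.
Let T1 : T 1 = 1 := proj1 (proj2 hT1).
Let TM : forall x y, T (x * y) = T x * T y := proj2 (proj2 hT1).

Lemma finField_card_gt1 : (1 < #|F|)%N.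
Proof. exact: finNzRing_gt1. Qed.

Lemma card_pred_gt0 : (0 < N)%N.
Proof. by have := finField_card_gt1; case: #|F| => [|[]]. Qed.

Lemma card_predK : N.+1 = #|F|.
Proof. by rewrite prednK // ltnW ?finField_card_gt1. Qed.

Lemma expf_pred x : x != 0 -> x ^+ N = 1 :> F.
Proof.
move=> x0; apply: (mulfI x0); rewrite -exprS card_predK mulr1.
exact: expf_card.
Qed.

Lemma finField_prim_root : exists g : F, N.-primitive_root g.
Proof.
have /hasP[g _ pg] : has N.-primitive_root (rem (0 : F) (enum F)); last by exists g.
apply: has_prim_root; rewrite ?rem_uniq ?enum_uniq ?card_pred_gt0 //.
  apply/allP => x; rewrite mem_rem_uniq ?enum_uniq // inE => /andP[x0 _].
  by rewrite unity_rootE expf_pred.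
by rewrite size_rem ?mem_enum // -cardE.
Qed.

Lemma char_expN x : x != 0 -> T x ^+ N = 1.
Proof. by move=> x0; rewrite -mcharX // expf_pred. Qed.

Lemma char_neq0 x : x != 0 -> T x != 0.
Proof.
move=> x0; apply/eqP => e; have /eqP := char_expN x0.
by rewrite e expr0n gtn_eqF ?card_pred_gt0 // eq_sym oner_eq0.
Qed.


(** If [T g] had order m, then T to the power m would be trivial on all powers of g, hence on all
    nonzero elements. *)
Lemma char_prim_root g : N.-primitive_root g -> N.-primitive_root (T g).
Proof.
move=> pg; have g0 : g != 0 by rewrite (prim_root_eq0 pg) gtn_eqF ?card_pred_gt0.
have [m pm dv] := prim_order_exists card_pred_gt0 (char_expN g0).
suff dv' : (N %| m)%N by have /eqP <- : m == N by rewrite eqn_dvd dv dv'.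
apply: (proj2 hT) => x x0; have [i ->] := prim_rootP pg (expf_pred x0).
by rewrite mcharX // exprAC (prim_expr_order pm) expr1n.
Qed.

Lemma char_eq1 x : x != 0 -> (T x == 1) = (x == 1).
Proof.
move=> x0; have [g pg] := finField_prim_root.
have [i ->] := prim_rootP pg (expf_pred x0).
by rewrite mcharX // -(prim_order_dvd (char_prim_root pg)) (prim_order_dvd pg).
Qed.

Lemma chpowE k x : x != 0 -> chpow T k x = T x ^+ k.
Proof. by rewrite /chpow => /negPf ->. Qed.

Lemma chpow0 k : chpow T k 0 = 0.
Proof. by rewrite /chpow eqxx. Qed.

Lemma chpow1 k : chpow T k 1 = 1.
Proof. by rewrite chpowE ?oner_eq0 // T1 expr1n. Qed.

Lemma chpowM k x y : chpow T k (x * y) = chpow T k x * chpow T k y.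
Proof. by case: (is_mchar_chpow k hT1) => _ []. Qed.

Lemma chpowD k l x : chpow T (k + l) x = chpow T k x * chpow T l x.
Proof. by rewrite /chpow; case: eqP; rewrite ?mul0r // exprD. Qed.

Lemma chpow_neq0 k x : x != 0 -> chpow T k x != 0.
Proof. by move=> x0; rewrite chpowE // expf_neq0 // char_neq0. Qed.

Lemma chpow_modn k l x : k = l %[mod N] -> chpow T k x = chpow T l x.
Proof.
rewrite /chpow; case: eqP => // /eqP x0 e.
have red m : T x ^+ m = T x ^+ (m %% N).
  by rewrite {1}(divn_eq m N) exprD mulnC exprM char_expN // expr1n mul1r.
by rewrite red e -red.
Qed.

Lemma chpow_dvd k x : (N %| k)%N -> x != 0 -> chpow T k x = 1.
Proof.
by move=> /dvdnP[m ->] x0; rewrite chpowE // mulnC exprM char_expN // expr1n.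
Qed.

Lemma chpow_sum k : \sum_x chpow T k x = if (N %| k)%N then N%:R else 0.
Proof.
rewrite (bigD1 0) //= chpow0 add0r; case: ifP => [dv|ndv].
  rewrite (eq_bigr (fun _ => 1)); last by move=> x x0; rewrite chpow_dvd.
  by rewrite sumr_const cardC1.
have [g pg] := finField_prim_root.
have g0 : g != 0 by rewrite (prim_root_eq0 pg) gtn_eqF ?card_pred_gt0.
have ne : chpow T k g != 1.
  by rewrite chpowE // -(prim_order_dvd (char_prim_root pg)) ndv.
set S := \sum_(_ | _) _; have /eqP : S = chpow T k g * S.
  rewrite {1}/S (reindex_inj (mulfI g0)) mulr_sumr.
  by apply: eq_big => x; rewrite ?mulf_eq0 ?(negPf g0) // chpowM.
rewrite -{1}[S]mul1r -subr_eq0 -mulrBl mulf_eq0 subr_eq0 eq_sym (negPf ne).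
by move/eqP.
Qed.

Lemma char_sum x : x != 0 ->
  \sum_(k < N) chpow T k x = if x == 1 then N%:R else 0.
Proof.
move=> x0; rewrite -char_eq1 // -sum_unity_root ?char_expN //.
by apply: eq_bigr => k _; rewrite chpowE.
Qed.

(** A natural number congruent to -k modulo N: the exponent of the inverse character. *)
Definition negx (k : nat) : nat := (N.-1 * k)%N.

Lemma negxP k : (N %| k + negx k)%N.
Proof. by rewrite /negx -mulSn prednK ?card_pred_gt0 // dvdn_mulr. Qed.

Lemma chpow_neg k x : x != 0 -> chpow T (negx k) x = (chpow T k x)^-1.
Proof.
move=> x0; apply: (mulfI (chpow_neq0 k x0)).
by rewrite -chpowD chpow_dvd ?negxP // divff ?chpow_neq0.
Qed.

Lemma conj_chpow k x : (chpow T (negx k) x)^* = chpow T k x.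
Proof.
have [->|x0] := eqVneq x 0; first by rewrite !chpow0 conjC0.
have nT : `|T x| = 1.
  apply/eqP; rewrite -(@pexpr_eq1 _ _ N) ?card_pred_gt0 //.
  by rewrite -normrX char_expN // normr1.
have cT : (T x)^* = (T x)^-1 by rewrite invC_norm nT expr1n invr1 mul1r.
rewrite chpow_neg // fmorphV chpowE // rmorphXn /= cT exprVn invrK //.
Qed.

(** A character of the cyclic unit group is determined by its value at a generator, an N-th root of
    unity; equal cardinalities turn this injection into a bijection with exponents. H must respect
    pointwise equality because the two descriptions of a character agree only pointwise. *)
Lemma sum_char_of (H : (F -> algC) -> algC) :
  (forall A B, A =1 B -> H A = H B) ->
  \sum_(i : Iirr (unitsG F)) H (char_of i) = \sum_(j < N) H (chpow T (negx j)).
Proof.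
move=> Hext; have [g pg] := finField_prim_root.
have g0 : g != 0 by rewrite (prim_root_eq0 pg) gtn_eqF ?card_pred_gt0.
have ug : g \is a GRing.unit by rewrite unitfE.
pose gu : {unit F} := FinRing.unit F ug.
have gE (x : {unit F}) : exists i : 'I_N, x = (gu ^+ i)%g.
  have x0 : val x != 0 by rewrite -unitfE; case: (x).
  have [i ei] := prim_rootP pg (expf_pred x0).
  by exists i; apply: val_inj; rewrite FinRing.val_unitX.
have ab : abelian (unitsG F) by apply: cyclic_abelian (field_unit_group_cyclic _).
have lin (i : Iirr (unitsG F)) := (char_abelianP _ ab) i.
(* This is the inverse of [T g]; taking powers of it makes j correspond to the exponent [negx j]. *)
have pu : N.-primitive_root (T g ^+ N.-1).
  by rewrite (prim_root_exp_coprime _ (char_prim_root pg)) coprimePn ?card_pred_gt0.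
have gN : (gu ^+ N = 1)%g.
  by apply: val_inj; rewrite FinRing.val_unitX /= (prim_expr_order pg).
have ex (i : Iirr (unitsG F)) : {j : 'I_N | 'chi_i gu = (T g ^+ N.-1) ^+ j}.
  by apply: prim_rootP => //; rewrite -(lin_charX (lin i)) ?in_setT // gN lin_char1.
pose f i := sval (ex i).
have fE i : 'chi_i gu = (T g ^+ N.-1) ^+ f i by rewrite /f; case: (ex i).
have injf : injective f.
  move=> i i' e; apply: irr_inj; apply: cfun_inP => x _.
  have [j ->] := gE x; rewrite !(lin_charX (lin _)) ?in_setT // !fE e //.
have bf : bijective f.
  apply: inj_card_bij injf _.
  by rewrite card_ord card_Iirr_abelian // card_finField_unit.
rewrite [RHS](reindex f) /=; last exact: onW_bij.
apply: eq_bigr => i _; apply: Hext => x; rewrite /char_of.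
case: insubP => [u _ <-|]; last by rewrite unitfE negbK => /eqP ->; rewrite chpow0.
have u0 : val u != 0 by rewrite -unitfE; case: (u).
have [j ej] := gE u.
rewrite ej (lin_charX (lin _)) ?in_setT // fE FinRing.val_unitX /=.
rewrite chpowE ?expf_neq0 // mcharX // /negx -!exprM.
by rewrite [(j * _)%N]mulnC mulnA.
Qed.

End Generator.

(** * Gauss sums *)

Lemma big_ord_dvd (V : nmodType) n d t (h : nat -> V) :
  n = (d * t)%N -> (0 < t)%N ->
  \sum_(k < n | (t %| k)%N) h k = \sum_(w < d) h (w * t)%N.
Proof.
move=> -> t0; rewrite -(big_mkord (fun k => (t %| k)%N) h).
elim: d => [|d IH]; first by rewrite mul0n big_geq // big_ord0.
rewrite big_ord_recr /= -IH mulSn addnC.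
rewrite (@big_cat_nat _ _ _ (d * t)) ?leq_addr //=; congr (_ + _).
have lt : (d * t < d * t + t)%N by rewrite -{1}[(d * t)%N]addn0 ltn_add2l.
rewrite big_ltn_cond // dvdn_mull //.
rewrite big_nat_cond big1 ?addr0 // => i /andP[/andP[lo hi] /dvdnP[m e]].
move: lo hi; rewrite e -mulSnr !ltn_pmul2r // ltnS => lo.
by rewrite leqNgt lo.
Qed.

Section GaussSums.
Variables (F : finFieldType) (T : F -> algC) (psi : F -> algC).
Hypothesis hT : is_char_generator T.
Hypotheses (psi0 : psi 0 = 1) (psiD : forall x y, psi (x + y) = psi x * psi y).
Hypothesis psi_sum : \sum_x psi x = 0.
Local Notation N := (#|F|.-1).
Local Notation G k := (gsum psi (chpow T k)).
Local Notation neg := (negx F).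

Lemma dvdn_neg k : (N %| neg k)%N = (N %| k)%N.
Proof.
by have := negxP F k; case: (boolP (N %| k)%N) => [dv|ndv] h;
  [rewrite dvdn_addr in h | apply: contraNF ndv => dv; rewrite dvdn_addl in h].
Qed.

Lemma gsum_modn k l : k = l %[mod N] -> G k = G l.
Proof. by move=> e; apply: eq_bigr => x _; rewrite (chpow_modn hT _ e). Qed.

Lemma sum_psi_neq0 : \sum_(x | x != 0) psi x = -1.
Proof.
by move/eqP: psi_sum; rewrite (bigD1 0) //= psi0 addrC addr_eq0 => /eqP.
Qed.

Lemma gsumE k : G k = \sum_(x | x != 0) T x ^+ k * psi x.
Proof.
rewrite /gsum (bigD1 0) //= chpow0 mul0r add0r.
by apply: eq_bigr => x x0; rewrite chpowE.
Qed.

Lemma gsum_dvd k : (N %| k)%N -> G k = -1.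
Proof.
move=> dv; rewrite gsumE -sum_psi_neq0; apply: eq_bigr => x x0.
by rewrite -chpowE // chpow_dvd // mul1r.
Qed.

Lemma sum_psi_scale a : \sum_x psi (a * x) = if a == 0 then #|F|%:R else 0.
Proof.
case: eqP => [->|/eqP a0].
  under eq_bigr do rewrite mul0r psi0.
  by rewrite sumr_const.
by have := psi_sum; rewrite (reindex_inj (mulfI a0)).
Qed.

Lemma gsum_scale k a : a != 0 ->
  \sum_x chpow T k x * psi (a * x) = (chpow T k a)^-1 * G k.
Proof.
move=> a0; rewrite /gsum [in RHS](reindex_inj (mulfI a0)) mulr_sumr.
apply: eq_bigr => x _; rewrite chpowM // !mulrA mulVf ?mul1r //.
exact: chpow_neq0.
Qed.

Lemma gsum_neg k : ~~ (N %| k)%N ->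
  G k * G (neg k) = chpow T k (-1) * #|F|%:R.
Proof.
move=> ndv; rewrite [G (neg k)]gsumE mulr_sumr.
(* Substitutes x = y z in the product of the two sums; the sum over y then detects z = -1. *)
transitivity (\sum_(y | y != 0) \sum_z chpow T k z * psi (y * (z + 1))).
  apply: eq_bigr => y y0.
  under [RHS]eq_bigr => z _ do rewrite mulrDr mulr1 psiD mulrA.
  by rewrite -mulr_suml gsum_scale // -chpowE // chpow_neg //; ring.
rewrite exchange_big /=.
transitivity (\sum_z chpow T k z * ((if z == -1 then #|F|%:R else 0) - 1)).
  apply: eq_bigr => z _; rewrite -mulr_sumr -addr_eq0 -sum_psi_scale.
  congr (_ * _); rewrite [in RHS](bigD1 0) //= mulr0 psi0 [1 + _]addrC addrK.
  by apply: eq_bigr => y _; rewrite mulrC.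
under eq_bigr do rewrite mulrBr mulr1.
rewrite big_split /= sumrN chpow_sum // (negPf ndv) subr0.
rewrite (bigD1 (-1)) //= eqxx big1 ?addr0 // => z /negPf ->.
by rewrite mulr0.
Qed.

Lemma card_natr_neq0 : #|F|%:R != 0 :> algC.
Proof. by rewrite pnatr_eq0 -lt0n ltnW // finField_card_gt1. Qed.

Lemma gsum_neq0 k : G k != 0.
Proof.
have [dv|ndv] := boolP (N %| k)%N; first by rewrite gsum_dvd // oppr_eq0 oner_eq0.
have /eqP := gsum_neg ndv; apply: contraTneq => ->.
rewrite mul0r eq_sym mulf_neq0 ?card_natr_neq0 //.
by rewrite chpow_neq0 // oppr_eq0 oner_eq0.
Qed.

(** Group the product of Gauss sums by s = x + y. By homogeneity each nonzero s gives [T^(a+b)] at s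
    times the Jacobi sum, and s = 0 gives nothing because [T^(a+b)] is nontrivial. *)
Lemma jacobi_gsum a b : ~~ (N %| a + b)%N ->
  (\sum_x chpow T a x * chpow T b (1 - x)) * G (a + b)%N = G a * G b.
Proof.
move=> ndv.
transitivity (\sum_s psi s * \sum_x chpow T a x * chpow T b (s - x)).
  have s00 : \sum_x chpow T a x * chpow T b (0 - x) = 0.
    under eq_bigr => x _ do rewrite sub0r -mulN1r chpowM // mulrCA -chpowD.
    by rewrite -mulr_sumr chpow_sum // (negPf ndv) mulr0.
  rewrite [RHS](bigD1 0) //= s00 mulr0 add0r.
  rewrite gsumE mulr_sumr; apply: eq_bigr => s s0.
  rewrite [X in psi s * X](_ : _ = chpow T (a + b) s *
      \sum_x chpow T a x * chpow T b (1 - x)); first by rewrite chpowE //; ring.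
  rewrite (reindex_inj (mulfI s0)) mulr_sumr; apply: eq_bigr => x _ /=.
  have -> : s - s * x = s * (1 - x) by ring.
  by rewrite !chpowM // chpowD //; ring.
under eq_bigr do rewrite mulr_sumr.
rewrite exchange_big /gsum mulr_suml; apply: eq_bigr => x _ /=.
rewrite (reindex_inj (addrI x)) mulr_sumr; apply: eq_bigr => y _ /=.
by rewrite [x + y]addrC addrK psiD; ring.
Qed.

(** Fourier inversion on the multiplicative group. At y = 0 the right side would vanish, which is
    why the torus is treated separately. *)
Lemma psi_fourier y : y != 0 ->
  N%:R * psi y = \sum_(m < N) G (neg m) * chpow T m y.
Proof.
move=> y0; under eq_bigr do rewrite gsumE mulr_suml.
have E x : x != 0 -> \sum_(m < N) T x ^+ neg m * psi x * chpow T m y =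
    psi x * if y / x == 1 then N%:R else 0.
  move=> x0; rewrite -(char_sum hT) ?mulf_neq0 ?invr_eq0 // mulr_sumr.
  apply: eq_bigr => m _; rewrite -chpowE // chpow_neg // chpowM //.
  suff -> : chpow T m x^-1 = (chpow T m x)^-1 by ring.
  apply: (mulfI (chpow_neq0 hT m x0)).
  by rewrite -chpowM // !divff ?chpow1 // chpow_neq0.
rewrite exchange_big (bigD1 y) //= E // divff // eqxx mulrC big1 ?addr0 // => x.
case/andP=> x0 xy; rewrite E // [_ == _](_ : _ = false) ?mulr0 //.
apply: contraNF xy => /eqP /(congr1 (fun u => u * x)); rewrite divfK // mul1r.
by move->.
Qed.

Section Divisor.
Variables (d : nat).
Hypothesis (d0 : (0 < d)%N) (dvd_d : (d %| N)%N).
Local Notation t := (N %/ d)%N.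

Lemma divisor_quo_gt0 : (0 < t)%N.
Proof. by rewrite divn_gt0 // dvdn_leq // card_pred_gt0. Qed.

Lemma divisor_quoE : N = (d * t)%N.
Proof. by rewrite mulnC divnK. Qed.

Lemma dvdn_divisor_mul k : (N %| d * k)%N = (t %| k)%N.
Proof. by rewrite -{1}(divnK dvd_d) [(t * d)%N]mulnC dvdn_pmul2l. Qed.

(** The number of d-th roots of y is expanded over all characters; the sum over x keeps only those
    whose d-th power is trivial, the exponents divisible by t. *)
Lemma sum_powers (H : F -> algC) :
  \sum_(x | x != 0) H (x ^+ d) =
  \sum_(y | y != 0) H y * \sum_(w < d) chpow T (w * t) y.
Proof.
have N0 : N%:R != 0 :> algC by rewrite pnatr_eq0 -lt0n card_pred_gt0.
have cnt y : y != 0 ->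
    \sum_(x | x != 0) ((x ^+ d == y)%:R : algC) = \sum_(w < d) chpow T (w * t) y.
  move=> y0; apply: (mulfI N0).
  rewrite -(big_ord_dvd (fun k => chpow T k y) divisor_quoE divisor_quo_gt0).
  rewrite !mulr_sumr.
  transitivity (\sum_(x | x != 0) \sum_(k < N) chpow T k y * chpow T (neg (d * k)) x).
    apply: eq_bigr => x x0; have xd0 : x ^+ d != 0 by rewrite expf_neq0.
    have := char_sum hT (mulf_neq0 y0 (invr_neq0 xd0)).
    have -> : (y / x ^+ d == 1) = (x ^+ d == y).
      by rewrite -(inj_eq (mulIf xd0)) divfK // mul1r eq_sym.
    rewrite [RHS](_ : _ = N%:R * (x ^+ d == y)%:R); last first.
      by case: eqP; rewrite ?mulr1 ?mulr0.
    move=> <-; apply: eq_bigr => k _; rewrite chpowM // chpow_neg //.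
    congr (_ * _); apply: (mulfI (chpow_neq0 hT k xd0)).
    rewrite -chpowM // divff // chpow1 // !chpowE // (mcharX _ _ (proj1 hT)).
    by rewrite -exprM divff // expf_neq0 // char_neq0.
  rewrite exchange_big /= [RHS]big_mkcond; apply: eq_bigr => k _ /=.
  have := chpow_sum hT (neg (d * k)); rewrite (bigD1 0) //= chpow0 add0r => e.
  rewrite -mulr_sumr e.
  have -> : (N %| neg (d * k))%N = (t %| k)%N.
    by rewrite -dvdn_divisor_mul dvdn_neg.
  by case: ifP; rewrite ?mulr0 // mulrC.
transitivity (\sum_(x | x != 0) \sum_(y | y != 0) H y * (x ^+ d == y)%:R).
  apply: eq_bigr => x x0; rewrite (bigD1 (x ^+ d)) ?expf_neq0 //= eqxx mulr1.
  rewrite big1 ?addr0 // => y /andP[_ /negPf]; rewrite eq_sym => ->.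
  by rewrite mulr0.
rewrite exchange_big; apply: eq_bigr => y y0 /=.
by rewrite -mulr_sumr cnt.
Qed.

Lemma natr_divisor_neq0 : d%:R != 0 :> F.
Proof.
have [g pg] := finField_prim_root F.
exact: prim_root_natf_neq0 (dvdn_prim_root pg dvd_d).
Qed.

Lemma hasse_davenport k :
  \prod_(i < d) G (k + i * t)%N =
  (chpow T (d * k) d%:R)^-1 * G (d * k)%N * \prod_(i < d.-1) G (i.+1 * t)%N.
Proof.
have [K [inF _]] := countable_algebraic_closure F.
have [g pg] := finField_prim_root F; have pw := dvdn_prim_root pg dvd_d.
have hrho := is_mchar_chpow t (proj1 hT).
have rho_sum z : z != 0 -> \sum_(i < d) chpow T t z ^+ i =
    if z ^+ t == 1 then d%:R else 0.
  move=> z0; rewrite -(char_eq1 hT) ?expf_neq0 // (mcharX _ _ (proj1 hT)).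
  rewrite chpowE // sum_unity_root // -exprM divnK // char_expN //.
have HD l : \prod_(i < d) G (l + i * t)%N =
    hd_const inF psi d * ((chpow T (d * l) d%:R)^-1 * G (d * l)%N).
  have := prod_gsum inF psi0 psiD psi_sum d0 dvd_d (is_mchar_chpow l (proj1 hT))
     hrho rho_sum pw.
  under eq_bigr => i _.
    rewrite (_ : gsum _ _ = G (l + i * t)%N); last first.
      apply: eq_bigr => x _; congr (_ * _); rewrite chpowD // /chmul; congr (_ * _).
      by rewrite /chpow; case: eqP => // _; rewrite -exprM mulnC.
    over.
  move=> ->; congr (_ * _); rewrite /gsum mulr_sumr.
  (* Substituting -(d c) for c turns the sum into a Gauss sum; it is injective because d is
     invertible in F. *)
  have inj : injective (fun c : F => - (c *+ d)).
    by move=> x y /oppr_inj /eqP; rewrite -(mulr_natr x) -(mulr_natr y)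
      (inj_eq (mulIf natr_divisor_neq0)) => /eqP.
  rewrite [RHS](reindex_inj inj); apply: eq_bigr => c _ /=; rewrite mulrA.
  congr (_ * _); have [->|c0] := eqVneq c 0.
    by rewrite mulr0 mul0rn oppr0 /chpow eqxx mulr0.
  have -> : - (c *+ d) = -1 * c * d%:R by rewrite mulN1r mulNr mulr_natr.
  rewrite [chpow T _ (-1 * c * _)]chpowM // mulrCA mulVf ?mulr1; last first.
    by rewrite chpow_neq0 // natr_divisor_neq0.
  rewrite [RHS]chpowM // {1}/chpow mulf_eq0 expf_eq0 oppr_eq0 oner_eq0.
  rewrite andbF (negPf c0) /= !chpowE ?oppr_eq0 ?oner_eq0 //; last first.
    by rewrite mulf_neq0 // expf_neq0 // oppr_eq0 oner_eq0.
  have [_ [_ TM]] := proj1 hT; rewrite TM (mcharX _ _ (proj1 hT)) -exprM.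
  rewrite exprMn -!exprM [(l * d)%N]mulnC mulrC [RHS]mulrC; congr (_ * _).
  (* The remaining powers of [T (-1)] agree because d * d and d have the same parity. *)
  have /eqP : T (-1) ^+ 2 = 1 by rewrite expr2 -TM mulrNN mul1r (proj1 (proj2 (proj1 hT))).
  rewrite sqrf_eq1 => /orP[] /eqP ->; first by rewrite !expr1n.
  by rewrite -signr_odd -[RHS]signr_odd !oddM; case: (odd d).
(* At exponent 0 both sides contain a trivial Gauss sum, -1; cancelling it evaluates [hd_const]. *)
rewrite HD; have := HD 0%N; rewrite muln0 gsum_dvd ?dvdn0 //.
rewrite chpow_dvd ?dvdn0 ?natr_divisor_neq0 // invr1 mul1r mulrN1.
rewrite -(big_mkord xpredT (fun i => G (0 + i * t)%N)) big_ltn // gsum_dvd //.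
rewrite big_add1 big_mkord mulN1r => /oppr_inj <-.
by rewrite mulrC; congr (_ * _); apply: eq_bigr => i _; rewrite add0n.
Qed.

End Divisor.
End GaussSums.

(** * The additive character *)

Section AdditiveCharacter.
Variables (F : finFieldType) (p : nat) (zeta : algC).
Hypotheses (hp : p \in [pchar F]) (hzeta : p.-primitive_root zeta).

Let p_prime : prime p. Proof. exact: pcharf_prime hp. Qed.

Lemma card_pchar : #|F| = (p ^ logn p #|F|)%N.
Proof. exact: (card_pprimeChar hp). Qed.

Lemma expr_pcharD i (x y : F) : (x + y) ^+ (p ^ i) = x ^+ (p ^ i) + y ^+ (p ^ i).
Proof.
by rewrite exprDn_pchar // pnatX (eq_pnat _ (pcharf_eq hp)) pnat_id.
Qed.

Lemma trFD : {morph trF p : x y / x + y >-> x + y :> F}.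
Proof.
move=> x y; rewrite /trF -big_split /=.
by apply: eq_bigr => i _; rewrite expr_pcharD.
Qed.

Lemma trF_pow (x : F) : trF p x ^+ p = trF p x.
Proof.
have n0 : (0 < logn p #|F|)%N.
  have := finField_card_gt1 F; rewrite {1}card_pchar.
  by case: (logn p _).
rewrite -(pFrobenius_autE hp) rmorph_sum /=.
under eq_bigr => i _ do rewrite pFrobenius_autE -exprM -expnSr.
rewrite /trF /qF -(prednK n0) big_ord_recr [RHS]big_ord_recl /=.
rewrite expn0 expr1 addrC; congr (_ + _).
by rewrite prednK // -card_pchar expf_card.
Qed.

(** The p elements of the prime field already exhaust the roots of [X^p - X]. *)
Lemma pow_pchar_nat (z : F) : z ^+ p = z -> exists k : 'I_p, k%:R = z.
Proof.
move=> zp; pose rs : seq F := [seq (k : nat)%:R | k : 'I_p <- enum 'I_p].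
suff /mapP[k _ ->] : z \in rs by exists k.
apply: contraT => zrs.
have nz : 'X^p - 'X != 0 :> {poly F}.
  rewrite -size_poly_eq0 size_polyDl size_polyXn // size_polyN size_polyX ltnS.
  exact: prime_gt1.
have: (size (z :: rs) < size ('X^p - 'X : {poly F})%R)%N.
  apply: max_poly_roots nz _ _ => /=.
    rewrite rootE !hornerE zp subrr eqxx /=; apply/allP => _ /mapP[k _ ->].
    by rewrite rootE !hornerE -(pFrobenius_autE hp) pFrobenius_aut_nat subrr.
  rewrite zrs map_inj_in_uniq ?enum_uniq // => i j _ _ e; apply/val_inj.
  wlog le_ij : i j e / (i <= j)%N.
    by move=> W; case: (leqP i j) => [/W -> //|/ltnW /W ->].
  have: (p %| j - i)%N by rewrite (dvdn_pcharf hp) natrB // e subrr.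
  rewrite -eqn_mod_dvd // !modn_small //; first by move/eqP.
rewrite size_polyDl size_polyXn ?size_polyN ?size_polyX ?ltnS ?prime_gt1 //=.
by rewrite size_map -cardE card_ord ltnn.
Qed.

(** The trace is fixed by Frobenius, so the default branch of [tr_nat] is never taken. *)
Lemma tr_natE (x : F) : (tr_nat p x)%:R = trF p x.
Proof.
rewrite /tr_nat; case: pickP => [k /eqP //|H].
by have [k e] := pow_pchar_nat (trF_pow x); have := H k; rewrite e eqxx.
Qed.

Lemma natr_eq_modn k l : k%:R = l%:R :> F -> k = l %[mod p].
Proof.
wlog le : k l / (k <= l)%N => [W e|e].
  by case: (leqP k l) => [/W|/ltnW/W h]; [exact | rewrite h].
apply/eqP; rewrite eq_sym eqn_mod_dvd // (dvdn_pcharf hp) natrB // e subrr //.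
Qed.

Lemma theta0 : theta p zeta (0 : F) = 1.
Proof.
have tr0 : trF p (0 : F) = 0 by apply: (addrI (trF p 0)); rewrite -trFD !addr0.
apply/eqP; rewrite -(prim_order_dvd hzeta) /dvdn -(mod0n p); apply/eqP.
by apply: natr_eq_modn; rewrite tr_natE tr0.
Qed.

Lemma thetaD (x y : F) : theta p zeta (x + y) = theta p zeta x * theta p zeta y.
Proof.
rewrite /theta -exprD; apply/eqP; rewrite (eq_prim_root_expr hzeta); apply/eqP.
by apply: natr_eq_modn; rewrite natrD !tr_natE trFD.
Qed.

(** The trace is a polynomial function of degree q / p, too small to vanish on all of F. *)
Lemma trF_nonzero : exists x : F, trF p x != 0.
Proof.
apply/existsP; apply: contraT; rewrite negb_exists => /forallP H.
have n0 : (0 < logn p #|F|)%N.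
  have := finField_card_gt1 F; rewrite {1}card_pchar.
  by case: (logn p _).
pose P : {poly F} := \sum_(i < logn p #|F|) 'X^(p ^ i).
have sP : size P = (p ^ (logn p #|F|).-1).+1.
  rewrite /P -(prednK n0) big_ord_recr /= addrC size_polyDl size_polyXn //.
  rewrite ltnS; apply: (leq_trans (size_sum _ _ _)); apply/bigmax_leqP => i _.
  by rewrite size_polyXn ltn_exp2l ?prime_gt1.
have nz : P != 0 by rewrite -size_poly_eq0 sP.
have : (size (enum F) < size P)%N.
  apply: max_poly_roots nz _ _; last exact: enum_uniq.
  apply/allP => x _; rewrite rootE /P horner_sum.
  under eq_bigr do rewrite hornerXn.
  by have := H x; rewrite negbK.
rewrite sP -cardE {1}card_pchar ltnS leq_exp2l ?prime_gt1 //.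
by rewrite -{1}(prednK n0) ltnn.
Qed.

Lemma sum_theta : \sum_(x : F) theta p zeta x = 0.
Proof.
have [a a0] := trF_nonzero.
have ne : theta p zeta a != 1.
  rewrite -(prim_order_dvd hzeta) (dvdn_pcharf hp).
  by rewrite tr_natE.
set S := \sum_x _; have /eqP : S = theta p zeta a * S.
  rewrite {1}/S (reindex_inj (addrI a)) mulr_sumr.
  by apply: eq_bigr => x _; rewrite thetaD.
rewrite -{1}[S]mul1r -subr_eq0 -mulrBl mulf_eq0 subr_eq0 eq_sym (negPf ne).
by move/eqP.
Qed.
End AdditiveCharacter.

(** * Greene's function *)

Lemma eq_jbinom (F : finFieldType) (A A' B B' : F -> algC) :
  A =1 A' -> B =1 B' -> jbinom A B = jbinom A' B'.
Proof.
move=> eA eB; rewrite /jbinom eB; congr (_ * _).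
by apply: eq_bigr => x _; rewrite eA eB.
Qed.

Section Greene.
Variables (F : finFieldType) (T : F -> algC) (psi : F -> algC).
Hypothesis hT : is_char_generator T.
Hypotheses (psi0 : psi 0 = 1) (psiD : forall x y, psi (x + y) = psi x * psi y).
Hypothesis psi_sum : \sum_x psi x = 0.
Local Notation N := (#|F|.-1).
Local Notation G k := (gsum psi (chpow T k)).
Local Notation neg := (negx F).
Local Notation q := (#|F|%:R : algC).
Variable n : nat.
Local Notation d := n.+2.
Hypothesis dvd_d : (d %| N)%N.
Local Notation t := (N %/ d)%N.

Lemma chpowN1_sqr k : chpow T k (-1) * chpow T k (-1) = 1.
Proof. by rewrite -chpowM // mulrNN mul1r chpow1. Qed.

Lemma chpowN1_inv k : (chpow T k (-1))^-1 = chpow T k (-1).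
Proof.
have m1 : chpow T k (-1) != 0 by rewrite chpow_neq0 // oppr_eq0 oner_eq0.
by apply: (mulfI m1); rewrite divff // chpowN1_sqr.
Qed.

(** The binomial holds the Jacobi sum of [T^(it-j)] and [T^j]. Their product [T^(it)] is nontrivial
    since 0 < i < d, so there is no exceptional j. *)
Lemma jbinom_gsum i j : (0 < i < d)%N ->
  jbinom (chmul (chpow T (i * t)) (chpow T (neg j))) (chpow T (neg j)) =
  chpow T j (-1) / q * (G (neg j + i * t)%N * G j / G (i * t)%N).
Proof.
case/andP=> i0 id; rewrite /jbinom -/(qF F).
have m1 : (-1 : F) != 0 by rewrite oppr_eq0 oner_eq0.
have modE : (neg j + i * t + j = i * t %[mod N])%N.
  by rewrite addnAC [(neg j + j)%N]addnC; have /dvdnP[m ->] := negxP F j; rewrite modnMDl.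
have ndv : ~~ (N %| neg j + i * t + j)%N.
  rewrite /dvdn modE -/(dvdn N (i * t)) {1}(divisor_quoE dvd_d).
  by rewrite dvdn_pmul2r ?divisor_quo_gt0 // gtnNdvd.
rewrite chpow_neg // chpowN1_inv; congr (_ * _).
rewrite -(jacobi_gsum hT psiD ndv) (gsum_modn psi hT modE).
rewrite mulfK ?gsum_neq0 //; apply: eq_bigr => x _.
by rewrite conj_chpow // /chmul -chpowD // addnC.
Qed.

(** The product formula at -j leaves the quotient [G (neg (d * j)) / G (neg j)]. Inverting both
    Gauss sums gives the main term, except that when N divides d j the numerator is -1 where the
    inversion would give -q. The second term is this discrepancy. *)
Lemma greene_term j lam : lam != 0 -> (j < N)%N ->
  q ^+ n * (q * ((\prod_(i < n.+1) jbinom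
      (chmul (chpow T (i.+1 * t)) (chpow T (neg j))) (chpow T (neg j))) *
    chpow T (neg j) (lam ^- d))) =
  G j ^+ d / G (d * j)%N * chpow T (d * j) (d%:R * lam) +
  if (t %| j)%N then (if j == 0%N then 0 else (q - 1) / q * G j ^+ d) else 0.
Proof.
move=> lam0 jN; have q0 := card_natr_neq0 F.
have dF0 : d%:R != 0 :> F by apply: natr_divisor_neq0.
have m1 : (-1 : F) != 0 by rewrite oppr_eq0 oner_eq0.
have -> : chpow T (neg j) (lam ^- d) = chpow T (d * j) lam.
  rewrite chpow_neg ?invr_eq0 ?expf_neq0 //.
  apply: (mulfI (chpow_neq0 hT j (invr_neq0 (expf_neq0 d lam0)))).
  rewrite divff ?chpow_neq0 ?invr_eq0 ?expf_neq0 //.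
  rewrite !chpowE ?invr_eq0 ?expf_neq0 // exprM -(mcharX lam d (proj1 hT)).
  rewrite -exprMn; case: (proj1 hT) => _ [T1 <-].
  by rewrite mulVf ?expf_neq0 // T1 expr1n.
under eq_bigr => i _ do rewrite (jbinom_gsum j (ltn_ord i : (0 < i.+1 < d)%N)).
rewrite !big_split /= !prodfV !prodr_const !card_ord.
set s := chpow T j (-1); set P := \prod_(i < n.+1) G (i.+1 * t)%N.
have HD := hasse_davenport hT psi0 psiD psi_sum (isT : (0 < d)%N) dvd_d (neg j).
move: HD; rewrite big_ord_recl /= mul0n addn0 -/P.
have -> : (d * neg j = neg (d * j))%N by rewrite /negx mulnCA.
rewrite [chpow T (neg _) _]chpow_neg // invrK chpowM // => HD.
have s0 : s != 0 by rewrite chpow_neq0.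
have ss : s * s = 1 by apply: chpowN1_sqr.
have P0 : P != 0 by apply/prodf_neq0 => i _; apply: gsum_neq0.
have gn k := gsum_neq0 hT psi0 psiD psi_sum k.
have HQ : \prod_(i < n.+1) G (neg j + i.+1 * t)%N =
    chpow T (d * j) d%:R * G (neg (d * j)) * P / G (neg j).
  by rewrite -HD [G (neg j) * _]mulrC mulfK.
rewrite HQ [q ^+ n.+1]exprSr [G j ^+ d]exprS.
set a := q ^+ n; set b := G j ^+ n.+1; set e := s ^+ n.+1.
have a0 : a != 0 by rewrite expf_neq0.
set D := chpow T _ d%:R; set L := chpow T _ lam.
have eE : e * s = chpow T (d * j) (-1) by rewrite /e /s -exprSr !chpowE // -exprM mulnC.
have ee : e * e = 1 by rewrite -exprMn ss expr1n.
(* At j = 0 the denominator [G (neg j)] is exceptional too, and the two missing factors q cancel. *)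
have [j0|jn0] := eqVneq j 0%N.
  have zE : (d * j = 0)%N by rewrite j0 muln0.
  have g0 k : k = 0%N -> G k = -1 by move=> ->; apply: gsum_dvd => //; rewrite dvdn0.
  have tj : (t %| j)%N by rewrite j0 dvdn0.
  rewrite tj addr0 (g0 (neg (d * j))) ?(g0 (neg j)) ?(g0 (d * j)%N) ?zE ?j0 ?/negx ?muln0 //.
  rewrite (g0 0%N) //.
  have -> : e = 1 by rewrite /e /s j0 /chpow oppr_eq0 oner_eq0 expr0 expr1n.
  by field; rewrite ?q0 ?P0 ?a0 ?oppr_eq0 ?oner_eq0.
have ndv : ~~ (N %| j)%N.
  by rewrite gtnNdvd // lt0n.
have Gn : G (neg j) = s * q / G j.
  by rewrite -(gsum_neg hT psi0 psiD psi_sum ndv) [G j * _]mulrC mulfK.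
rewrite Gn -(dvdn_divisor_mul _ dvd_d) //.
case: (boolP (N %| d * j)%N) => dj; last first.
  have -> : G (neg (d * j)) = e * s * q / G (d * j)%N.
    by rewrite eE -(gsum_neg hT psi0 psiD psi_sum dj) [G _ * G _]mulrC mulfK.
  rewrite addr0 -[RHS]mul1r -ee; field.
  by rewrite !gn s0 q0 P0 a0 (expf_neq0 _ s0).
have -> : e = s by apply: (mulIf s0); rewrite ss eE chpow_dvd.
have -> : G (neg (d * j)) = -1 by apply: gsum_dvd => //; rewrite dvdn_neg.
have -> : G (d * j)%N = -1 by apply: gsum_dvd.
have -> : D = 1 by apply: chpow_dvd.
have -> : L = 1 by apply: chpow_dvd.
field.
by rewrite ?gn ?s0 ?q0 ?P0 ?a0 ?oppr_eq0 ?oner_eq0.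
Qed.

Lemma natr_card_pred : N%:R = q - 1.
Proof. by rewrite -{2}(card_predK F) -natr1 addrK. Qed.

Lemma greene_gsum lam : lam != 0 ->
  q ^+ n * greeneF (fun i : 'I_n.+1 => chpow T (i.+1 * t)%N)
                   (fun _ : 'I_n => @eps F) (lam ^- d) =
  (q - 1)^-1 * \sum_(j < N) G j ^+ d / G (d * j)%N * chpow T (d * j) (d%:R * lam)
  + q^-1 * \sum_(c < n.+1) G (c.+1 * t)%N ^+ d.
Proof.
move=> lam0; have q0 := card_natr_neq0 F.
have q10 : q - 1 != 0 by rewrite -natr_card_pred pnatr_eq0 -lt0n card_pred_gt0.
pose H (chi : F -> algC) := jbinom (chmul (chpow T (1 * t)) chi) chi *
  (\prod_(k < n) jbinom (chmul (chpow T (k.+2 * t)%N) chi) (chmul (@eps F) chi)) *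
  chi (lam ^- d).
have Hext A B : A =1 B -> H A = H B.
  move=> e; rewrite /H e; congr (_ * _ * _).
    by apply: eq_jbinom => // x; rewrite /chmul e.
  by apply: eq_bigr => k _; apply: eq_jbinom => x; rewrite /chmul e.
have -> : greeneF (fun i : 'I_n.+1 => chpow T (i.+1 * t)%N)
    (fun _ : 'I_n => @eps F) (lam ^- d) =
    q / (q - 1) * \sum_(i : Iirr (unitsG F)) H (char_of i) by [].
rewrite (sum_char_of hT Hext) mulrCA mulr_sumr mulr_sumr mulr_sumr.
transitivity (\sum_(j < N) (q - 1)^-1 *
   (q ^+ n * (q * ((\prod_(i < n.+1) jbinom
      (chmul (chpow T (i.+1 * t)) (chpow T (neg j))) (chpow T (neg j))) *
    chpow T (neg j) (lam ^- d))))).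
  apply: eq_bigr => j _; rewrite /H big_ord_recl /=.
  (* Multiplying by [eps] changes nothing at 0 either, as the character vanishes there. *)
  under [in RHS]eq_bigr => i _.
    rewrite -(@eq_jbinom _ _ _ (chmul (@eps F) (chpow T (neg j))) _ (frefl _)).
      over.
    by move=> x; rewrite /chmul /eps /chpow; case: eqP; rewrite ?mul0r ?mul1r.
  by rewrite /bump /=; ring.
under eq_bigr => j _ do rewrite greene_term // mulrDr.
rewrite big_split /=; congr (_ + _); rewrite -[LHS]mulr_sumr -big_mkcond.
pose h k := if k == 0%N then 0 else (q - 1) / q * G k ^+ d.
rewrite (big_ord_dvd h (divisor_quoE dvd_d) (divisor_quo_gt0 (ltn0Sn n.+1) dvd_d)).
rewrite big_ord_recl /= {1}/h eqxx add0r mulr_sumr mulr_sumr.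
apply: eq_bigr => c _; rewrite /h /bump /= gtn_eqF ?muln_gt0 ?divisor_quo_gt0 //.
by rewrite add1n; field; rewrite q0 q10.
Qed.

End Greene.

(** * Counting points *)

Lemma sum_periodic_shift (V : zmodType) N (f : nat -> V) s :
  (forall j, f (j + N)%N = f j) ->
  \sum_(j < N) f (j + s)%N = \sum_(j < N) f j.
Proof.
move=> per; elim: s => [|s IH]; first by apply: eq_bigr => j _; rewrite addn0.
rewrite -IH; case: N per {IH} => [|N] per; first by rewrite !big_ord0.
rewrite big_ord_recr [RHS]big_ord_recl /= addrC; congr (_ + _).
  by rewrite -[RHS]per add0n addnC addSnnS addnC.
by apply: eq_bigr => j _; rewrite /bump /= add1n addSnnS.
Qed.

Lemma sum_periodic_mul (V : zmodType) d t (f : nat -> V) :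
  (forall j, f (j + t)%N = f j) ->
  \sum_(j < d * t) f j = (\sum_(j < t) f j) *+ d.
Proof.
move=> per; rewrite -(big_mkord xpredT f).
elim: d => [|d IH]; first by rewrite mul0n big_geq // mulr0n.
rewrite mulSn (@big_cat_nat _ _ _ t) ?leq_addr //= big_mkord mulrS.
congr (_ + _); rewrite -IH -{1}[t]add0n big_addn addnC addnK.
by apply: eq_bigr => j _; rewrite per.
Qed.

Section Projective.
Variables (F : finFieldType) (d : nat) (c : F).
Hypothesis d0 : (0 < d)%N.
Local Notation aff := [set x : {ffun 'I_d -> F} | \sum_i x i ^+ d == c * \prod_i x i].
Local Notation norm := [set x : {ffun 'I_d -> F} | proj_normalized x &&
      (\sum_i x i ^+ d == c * \prod_i x i)].

Definition fscale (a : F) (x : {ffun 'I_d -> F}) : {ffun 'I_d -> F} :=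
  [ffun i => a * x i].

Lemma fscaleE a x i : fscale a x i = a * x i.
Proof. by rewrite ffunE. Qed.

Lemma fscale_aff a x : x \in aff -> fscale a x \in aff.
Proof.
rewrite !inE => /eqP e.
under [X in X == _]eq_bigr do rewrite fscaleE exprMn.
under [X in _ * X]eq_bigr do rewrite fscaleE.
by rewrite big_split /= prodr_const card_ord -mulr_sumr e mulrCA.
Qed.

Lemma card_aff : #|aff| = (#|F|.-1 * #|norm|).+1.
Proof.
have z_aff : [ffun=> 0] \in aff.
  rewrite inE big1 => [|i _]; last by rewrite ffunE expr0n gtn_eqF.
  by rewrite (bigD1 (Ordinal d0)) //= ffunE mul0r mulr0.
rewrite (cardsD1 [ffun=> 0]) z_aff add1n; congr _.+1.
have -> : #|F|.-1 = #|[set~ (0 : F)]| by rewrite cardsC1.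
rewrite -cardsX -(card_in_imset (f := fun ax => fscale ax.1 ax.2)).
  apply: eq_card => x; rewrite in_setD1; apply/andP/imsetP => [[xn0 xa]|].
    have [i0 xi0] : exists i, x i != 0.
      apply/existsP; apply: contraNT xn0; rewrite negb_exists => /forallP H.
      by apply/eqP/ffunP => i; rewrite ffunE; apply/eqP; have := H i; rewrite negbK.
    case: (arg_minnP (P := fun i => x i != 0) (fun i : 'I_d => i : nat) xi0).
    move=> i xi imin; exists (x i, fscale (x i)^-1 x).
      rewrite in_setX in_setC1 xi /= inE.
      move: (fscale_aff (x i)^-1 xa); rewrite inE => ->; rewrite andbT.
      apply/existsP; exists i; rewrite ffunE mulVf // eqxx.
      apply/forallP => j; apply/implyP => ji; rewrite ffunE mulf_eq0.
      apply/orP; right; apply: contraTT ji => xj; rewrite -leqNgt; exact: imin.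
    by apply/ffunP => j; rewrite !ffunE mulrA divff // mul1r.
  case=> -[a y]; rewrite in_setX in_setC1 /= inE => /andP[a0 /andP[ny ya]] ->.
  split; last by apply: fscale_aff; rewrite inE.
  case/existsP: ny => i /andP[/eqP yi _]; apply/eqP => /ffunP /(_ i).
  by rewrite !ffunE yi mulr1; apply/eqP.
move=> [a x] [b y]; rewrite !in_setX !in_setC1 /= !inE.
move=> /andP[a0 /andP[/existsP[i /andP[/eqP xi /forallP xmin]] _]].
move=> /andP[b0 /andP[/existsP[j /andP[/eqP yj /forallP ymin]] _]] /ffunP e.
have ij : i = j.
  apply/val_inj/eqP; rewrite eqn_leq; apply/andP; split; rewrite leqNgt; apply/negP => lt.
    have := e j; rewrite !ffunE yj (eqP (implyP (xmin j) lt)) mulr0 mulr1.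
    by move/esym/eqP; rewrite (negPf b0).
  have := e i; rewrite !ffunE xi (eqP (implyP (ymin i) lt)) mulr0 mulr1.
  by move/eqP; rewrite (negPf a0).
have ab : a = b by have := e i; rewrite !ffunE xi ij yj !mulr1.
rewrite ab; congr (_, _); apply/ffunP => k; apply: (mulfI b0).
by have := e k; rewrite !ffunE ab.
Qed.
End Projective.

Section Count.
Variables (F : finFieldType) (T : F -> algC) (psi : F -> algC).
Hypothesis hT : is_char_generator T.
Hypotheses (psi0 : psi 0 = 1) (psiD : forall x y, psi (x + y) = psi x * psi y).
Hypothesis psi_sum : \sum_x psi x = 0.
Local Notation N := (#|F|.-1).
Local Notation G k := (gsum psi (chpow T k)).
Local Notation neg := (negx F).
Local Notation q := (#|F|%:R : algC).
Variable n : nat.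
Local Notation d := n.+2.
Hypothesis dvd_d : (d %| N)%N.
Local Notation t := (N %/ d)%N.
Local Notation W := {ffun 'I_d -> 'I_d}.
Implicit Types (w : W) (c a : F) (x : {ffun 'I_d -> F}).

Definition gprod w (j : nat) : algC := \prod_(i < d) G (w i * t + j)%N.

Lemma psi_sumr (I : finType) (f : I -> F) : psi (\sum_i f i) = \prod_i psi (f i).
Proof. exact: (big_morph psi psiD psi0). Qed.

(** Once the product is expanded, a occurs through the character with exponent -t times the sum of
    the [w i]. Summing over a keeps the tuples with sum divisible by d, which is how W arises. *)
Lemma sum_chars_Wset (g : 'I_d -> algC) :
  \sum_(a | a != 0) \prod_(i < d) (\sum_(w < d) (chpow T (w * t) a)^-1 * g w) =
  N%:R * \sum_(w in Wset d) \prod_(i < d) g (w i).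
Proof.
under eq_bigr do rewrite bigA_distr_bigA.
rewrite exchange_big /= mulr_sumr [RHS]big_mkcond; apply: eq_bigr => w _ /=.
pose s := (\sum_i (w i : nat))%N.
transitivity (\sum_(a | a != 0) chpow T (neg (s * t)) a * \prod_(i < d) g (w i)).
  apply: eq_bigr => a a0; rewrite big_split /= chpow_neg // prodfV; congr (_^-1 * _).
  rewrite chpowE // /s big_distrl expr_sum; apply: eq_bigr => i _.
  by rewrite chpowE.
have := chpow_sum hT (neg (s * t)); rewrite (bigD1 0) //= chpow0 add0r => e.
rewrite -mulr_suml e dvdn_neg mulnC [X in (X %| _)%N](divisor_quoE dvd_d) mulnC.
rewrite dvdn_pmul2l ?divisor_quo_gt0 // inE /dvdn -/s.
by case: ifP => _; rewrite ?mul0r.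
Qed.

Lemma sum_power_psi j a : a != 0 ->
  \sum_y chpow T (j * d) y * psi (a * y ^+ d) =
  \sum_(w < d) (chpow T (w * t + j) a)^-1 * G (w * t + j)%N.
Proof.
move=> a0; rewrite (bigD1 0) //= chpow0 mul0r add0r.
pose H y := chpow T j y * psi (a * y).
transitivity (\sum_(y | y != 0) H (y ^+ d)).
  apply: eq_bigr => y y0; rewrite /H; congr (_ * _).
  by rewrite !chpowE ?expf_neq0 // (mcharX _ _ (proj1 hT)) -exprM mulnC.
rewrite (sum_powers hT (ltn0Sn _) dvd_d).
under [LHS]eq_bigr do rewrite mulr_sumr.
rewrite exchange_big /=; apply: eq_bigr => w _; rewrite -gsum_scale //.
rewrite [RHS](bigD1 0) //= chpow0 mul0r add0r.
apply: eq_bigr => y _.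
by rewrite /H chpowD; ring.
Qed.

(** Multiplying y by a primitive d-th root of unity fixes [y ^+ d] and scales the sum by a factor
    other than 1. *)
Lemma sum_power_psi0 m a : ~~ (d %| m)%N ->
  \sum_y chpow T m y * psi (a * y ^+ d) = 0.
Proof.
move=> ndv; have [g pg] := finField_prim_root F.
have g0 : g != 0 by rewrite (prim_root_eq0 pg) gtn_eqF ?card_pred_gt0.
have pw := dvdn_prim_root pg dvd_d; set u := g ^+ t in pw.
have u0 : u != 0 by rewrite expf_neq0.
have ne : chpow T m u != 1.
  rewrite chpowE // -(mcharX _ _ (proj1 hT)) char_eq1 ?expf_neq0 //.
  by rewrite -(prim_order_dvd pw).
set S := \sum_y _; have /eqP : S = chpow T m u * S.
  rewrite {1}/S (reindex_inj (mulfI u0)) mulr_sumr; apply: eq_bigr => y _.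
  by rewrite chpowM // exprMn (prim_expr_order pw) mul1r mulrA.
rewrite -{1}[S]mul1r -subr_eq0 -mulrBl mulf_eq0 subr_eq0 eq_sym (negPf ne).
by move/eqP.
Qed.

Definition in_torus x : bool := [forall i, x i != 0].

Lemma torus_prod (f : F -> algC) : f 0 = 0 ->
  \sum_(x : {ffun 'I_d -> F} | in_torus x) \prod_(i < d) f (x i) =
  \prod_(i < d) \sum_y f y.
Proof.
move=> f0; rewrite bigA_distr_bigA big_mkcond; apply: eq_bigr => x _ /=.
case: ifP => // /negbT; rewrite negb_forall => /existsP[i].
by rewrite negbK => /eqP e; rewrite (bigD1 i) //= e f0 mul0r.
Qed.

Definition torus_sum a c : algC :=
  \sum_(x : {ffun 'I_d -> F} | in_torus x)
     psi (a * (\sum_i x i ^+ d - c * \prod_i x i)).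

Lemma torus_sum0 :
  \sum_(a | a != 0) torus_sum a 0 = N%:R * \sum_(w in Wset d) gprod w 0.
Proof.
rewrite /gprod -(sum_chars_Wset (fun i => G (i * t + 0)%N)).
apply: eq_bigr => a a0.
transitivity (\prod_(i < d) \sum_y chpow T (0 * d) y * psi (a * y ^+ d)).
  rewrite -(torus_prod (f := fun y => chpow T (0 * d) y * psi (a * y ^+ d)));
    last by rewrite chpow0 mul0r.
  apply: eq_bigr => x /forallP tx; rewrite mul0r subr0 mulr_sumr psi_sumr.
  by apply: eq_bigr => i _; rewrite chpowE // mul0n expr0 mul1r.
apply: eq_bigr => i _; rewrite sum_power_psi //.
by apply: eq_bigr => w _; rewrite addn0.
Qed.

(** Only the factor containing the monomial is expanded. Since characters are multiplicative, the
    variables separate into one-variable sums. *)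
Lemma torus_sum_fourier a c : a != 0 -> c != 0 ->
  N%:R * torus_sum a c = \sum_(m < N) G (neg m) * chpow T m (- (a * c)) *
    \prod_(i < d) \sum_y chpow T m y * psi (a * y ^+ d).
Proof.
move=> a0 c0; rewrite mulr_sumr.
under [RHS]eq_bigr => m _.
  rewrite -(torus_prod (f := fun y => chpow T m y * psi (a * y ^+ d)));
    last by rewrite chpow0 mul0r.
  rewrite mulr_sumr; over.
rewrite exchange_big; apply: eq_bigr => x /forallP tx /=.
have P0 : \prod_i x i != 0 by apply/prodf_neq0 => i _; apply: tx.
rewrite mulrBr psiD [a * \sum_i _]mulr_sumr psi_sumr mulrCA.
have -> : - (a * (c * \prod_i x i)) = - (a * c) * \prod_i x i by ring.
rewrite (psi_fourier psi hT) ?mulf_neq0 ?oppr_eq0 ?mulf_neq0 //.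
rewrite mulr_sumr; apply: eq_bigr => m _; rewrite chpowM // big_split /=.
have -> : chpow T m (\prod_i x i) = \prod_i chpow T m (x i).
  exact: (big_morph _ (chpowM hT m) (chpow1 hT m)).
ring.
Qed.

(** Only exponents m = d j survive, with j modulo t. The factor d on the left lets j run modulo N
    instead. *)
Lemma torus_sum_total c : c != 0 ->
  d%:R * \sum_(a | a != 0) torus_sum a c =
  \sum_(j < N) G (neg (d * j)) * chpow T (d * j) (- c) *
     \sum_(w in Wset d) gprod w j.
Proof.
move=> c0; have N0 : N%:R != 0 :> algC by rewrite pnatr_eq0 -lt0n card_pred_gt0.
apply: (mulfI N0).
transitivity (\sum_(a | a != 0) \sum_(j < N)
   G (neg (d * j)) * chpow T (d * j) (- c) *
   \prod_(i < d) \sum_(w < d) (chpow T (w * t) a)^-1 * G (w * t + j)%N).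
  rewrite mulrCA mulr_sumr mulr_sumr; apply: eq_bigr => a a0.
  rewrite torus_sum_fourier //.
  pose h m := G (neg m) * chpow T m (- (a * c)) *
    \prod_(i < d) \sum_y chpow T m y * psi (a * y ^+ d).
  have hmod k l : k = l %[mod N] -> h k = h l.
    move=> e; rewrite /h (chpow_modn hT _ e).
    have -> : G (neg k) = G (neg l).
      by apply: gsum_modn => //; rewrite /negx -modnMmr e modnMmr.
    congr (_ * _); apply: eq_bigr => i _; apply: eq_bigr => y _.
    by rewrite (chpow_modn hT _ e).
  have NE : N = (t * d)%N by rewrite divnK.
  have -> : \sum_(m < N) G (neg m) * chpow T m (- (a * c)) *
      (\prod_(i < d) \sum_y chpow T m y * psi (a * y ^+ d)) =
      \sum_(i < t) h (i * d)%N.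
    rewrite -(big_ord_dvd h NE (ltn0Sn _)) [RHS]big_mkcond.
    apply: eq_bigr => m _ /=; case: ifPn => // ndv.
    by rewrite (bigD1 ord0) //= sum_power_psi0 // mul0r mulr0.
  rewrite mulr_natl -(@sum_periodic_mul _ d t (fun i => h (i * d)%N)).
    rewrite -(divisor_quoE dvd_d); apply: eq_bigr => j _; rewrite /h mulnC.
    under eq_bigr => i _ do rewrite mulnC sum_power_psi //.
    have -> : - (a * c) = a * - c by rewrite mulrN.
    rewrite chpowM //.
    (* The d copies of the inverse of [T^j] at a cancel the factor [T^(dj)] at a coming from the
       monomial. *)
    have -> : \prod_(i < d) \sum_(w < d) (chpow T (w * t + j) a)^-1 * G (w * t + j)%N =
        (chpow T (d * j) a)^-1 *
        \prod_(i < d) \sum_(w < d) (chpow T (w * t) a)^-1 * G (w * t + j)%N.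
      rewrite [chpow T (d * j) a]chpowE // mulnC exprM -exprVn.
      rewrite -[X in _ ^+ X](card_ord d) -prodr_const -big_split /=.
      apply: eq_bigr => i _; rewrite mulr_sumr; apply: eq_bigr => w _.
      by rewrite -chpowE // chpowD invfM; ring.
    by field; rewrite chpow_neq0.
  by move=> j; apply: hmod; rewrite mulnDl -NE modnDr.
rewrite exchange_big mulr_sumr; apply: eq_bigr => j _ /=.
rewrite -mulr_sumr (sum_chars_Wset (fun i => G (i * t + j)%N)) mulrCA.
by [].
Qed.

End Count.

(** * Classes of tuples *)

Section Shift.
Variable n : nat.
Local Notation d := n.+2.
Local Notation W := {ffun 'I_d -> 'I_d}.
Implicit Types (w : W) (c : 'I_d).

(** Addition in ['I_d] is modulo d, so the classes of W are the orbits of these translations. *)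
Definition wshift c w : W := [ffun i => (w i + c)%R].

Lemma wshiftE c w i : wshift c w i = (w i + c)%R.
Proof. by rewrite ffunE. Qed.

Lemma val_wshift c w i : (wshift c w i : nat) = ((w i + c) %% d)%N.
Proof. by rewrite ffunE. Qed.

Lemma wshiftK c : cancel (wshift c) (wshift (- c)).
Proof. by move=> w; apply/ffunP => i; rewrite !wshiftE addrK. Qed.

Lemma wshift_inj c : injective (wshift c).
Proof. exact: can_inj (wshiftK c). Qed.

Lemma wshift_Wset c w : (wshift c w \in Wset d) = (w \in Wset d).
Proof.
rewrite !inE; under eq_bigr do rewrite val_wshift.
by rewrite modn_summ big_split /= sum_nat_const card_ord addnC mulnC modnMDl.
Qed.

Lemma WequivP w w' : reflect (exists c, w = wshift c w') (Wequiv w w').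
Proof.
apply: (iffP existsP) => -[c h]; exists c.
  apply/ffunP => i; apply: ord_inj; rewrite val_wshift.
  by rewrite (eqP (forallP h i)) modn_small.
by apply/forallP => i; rewrite h val_wshift modn_mod.
Qed.

Lemma Wequiv_equivalence : {in Wset d & &, equivalence_rel (@Wequiv d)}.
Proof.
have refl w : Wequiv w w.
  by apply/WequivP; exists 0; apply/ffunP => i; rewrite wshiftE addr0.
move=> x y z _ _ _; split=> // /WequivP[c ->]; apply/WequivP/WequivP => -[e].
  move=> /(congr1 (wshift (- c))); rewrite wshiftK => ->.
  by exists (e - c); apply/ffunP => i; rewrite !wshiftE addrA.
by move=> ->; exists (e + c); apply/ffunP => i; rewrite !wshiftE addrA.
Qed.

Lemma Wclasses_partition : partition (Wclasses d) (Wset d).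
Proof. exact: equivalence_partitionP Wequiv_equivalence. Qed.

Lemma card_Wclass w : w \in Wset d -> #|Wclass w| = d.
Proof.
move=> wW; have -> : Wclass w = [set wshift c w | c in 'I_d].
  apply/setP => w'; rewrite inE; apply/andP/imsetP.
    case=> _ /WequivP[c ->]; exists (- c) => //.
    by rewrite wshiftK.
  case=> c _ ->; rewrite wshift_Wset wW; split=> //; apply/WequivP.
  by exists (- c); rewrite wshiftK.
rewrite card_imset ?card_ord // => c e /ffunP /(_ ord0); rewrite !wshiftE.
exact: addrI.
Qed.

(* The representative chosen by [sum_classes] is irrelevant for a
   shift-invariant summand, and every class has [d] elements. *)
Lemma sum_classes_Wset (P : pred {set W}) (f : W -> algC) :
  (forall c w, f (wshift c w) = f w) ->
  \sum_(C in Wclasses d | P C) \sum_(w in C) f w = d%:R * sum_classes P f.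
Proof.
move=> fshift; rewrite /sum_classes mulr_sumr; apply: eq_bigr => C /andP[CW _].
case/imsetP: CW => w0 w0W ->.
have fE w : w \in Wclass w0 -> f w = f w0.
  by rewrite inE => /andP[_ /WequivP[c ->]]; rewrite fshift.
rewrite (eq_bigr (fun _ => f w0)) => [|w /fE //].
rewrite sumr_const card_Wclass // mulr_natl.
case: pickP => [w /fE -> //|/(_ w0)]; rewrite !inE in w0W *.
rewrite w0W (_ : Wequiv w0 w0) //.
by apply/WequivP; exists 0; apply/ffunP => i; rewrite wshiftE addr0.
Qed.

Lemma is_zero_classE C : C \in Wclasses d ->
  is_zero_class C = (C == Wclass [ffun=> 0]).
Proof.
case/imsetP=> w0 w0W CE.
apply/existsP/eqP => [[w /andP[wC /forallP w0']]|->].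
  have wz : w = [ffun=> 0] by apply/ffunP => i; rewrite ffunE; apply/val_inj/eqP; exact: w0'.
  rewrite -wz CE; move: wC; rewrite CE inE => /andP[wW ew].
  apply/setP => w'; rewrite ![w' \in Wclass _]in_set; apply: andb_id2l => w'W.
  by have [_ /(_ ew) ->] := Wequiv_equivalence w0W wW w'W.
exists [ffun=> 0]; apply/andP; split; last by apply/forallP => i; rewrite ffunE.
have zW : [ffun=> 0] \in Wset d.
  by rewrite inE big1 ?mod0n // => i _; rewrite ffunE.
rewrite inE zW; apply/WequivP; exists 0; apply/ffunP => i.
by rewrite wshiftE addr0.
Qed.

Lemma zero_class_in : Wclass [ffun=> 0] \in Wclasses d.
Proof.
by apply: imset_f; rewrite inE big1 ?mod0n // => i _; rewrite ffunE.
Qed.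

Lemma sum_classes_zero (f : W -> algC) :
  (forall c w, f (wshift c w) = f w) ->
  \sum_(w in Wset d) f w =
  d%:R * (sum_classes (fun C => ~~ is_zero_class C) f + f [ffun=> 0]).
Proof.
move=> fshift; rewrite (set_partition_big _ Wclasses_partition) /=.
rewrite (bigID (@is_zero_class d)) /= addrC mulrDr sum_classes_Wset //.
congr (_ + _); rewrite (big_pred1 (Wclass [ffun=> 0])) => [|C]; last first.
  rewrite /=; case: (boolP (C \in _)) => [/is_zero_classE //|].
  by move=> CN; apply/esym; apply: contraNF CN => /eqP ->; exact: zero_class_in.
rewrite (eq_bigr (fun _ => f [ffun=> 0])) => [|w]; last first.
  rewrite inE => /andP[_ /WequivP[c e]]; rewrite e fshift //.
rewrite sumr_const card_Wclass ?mulr_natl //.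
by rewrite inE big1 ?mod0n // => i _; rewrite ffunE.
Qed.

(** A constant tuple c has sum d c and so always lies in W: each nonzero c contributes once. *)
Lemma sum_Wset_nonzero (g : 'I_d -> algC) :
  \sum_(w in Wset d | [forall i, w i != 0]) \prod_(i < d) g (w i) =
  \sum_(w in Wss d) \prod_(i < d) g (w i) + \sum_(c : 'I_d | c != 0) g c ^+ d.
Proof.
rewrite (bigID (fun w : W => [forall i, forall j, w i == w j])) /= addrC.
congr (_ + _).
  by apply: eq_bigl => w; rewrite [in RHS]inE andbA.
rewrite (reindex_onto (fun c : 'I_d => [ffun=> c] : W) (fun w : W => w ord0)) /=.
  apply: eq_big => [c|c _]; last first.
    by under eq_bigr do rewrite ffunE; rewrite prodr_const card_ord.
  rewrite ffunE eqxx andbT.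
  rewrite (_ : [forall i, forall j, _] = true) ?andbT; last first.
    by apply/forallP => i; apply/forallP => j; rewrite !ffunE.
  rewrite inE; under eq_bigr do rewrite ffunE.
  rewrite sum_nat_const card_ord modnMr eqxx /=.
  by apply/forallP/idP => [/(_ ord0)|c0 i]; rewrite ffunE.
move=> w /andP[_ /forallP h]; apply/ffunP => i; rewrite ffunE.
by apply/eqP; exact: (forallP (h ord0) i).
Qed.
End Shift.

(** * The point count *)

Section Final.
Variables (F : finFieldType) (T : F -> algC) (psi : F -> algC).
Hypothesis hT : is_char_generator T.
Hypotheses (psi0 : psi 0 = 1) (psiD : forall x y, psi (x + y) = psi x * psi y).
Hypothesis psi_sum : \sum_x psi x = 0.
Local Notation N := (#|F|.-1).
Local Notation G k := (gsum psi (chpow T k)).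
Local Notation neg := (negx F).
Local Notation q := (#|F|%:R : algC).
Variable n : nat.
Local Notation d := n.+2.
Hypothesis dvd_d : (d %| N)%N.
Local Notation t := (N %/ d)%N.
Local Notation W := {ffun 'I_d -> 'I_d}.
Local Notation gprod := (gprod T psi).
Implicit Types (w : W) (c a : F) (x : {ffun 'I_d -> F}).

Definition gratio c w : algC :=
  \sum_(j < N) gprod w j / G (d * j)%N * chpow T (d * j) c.

Lemma gprod_modn w j k : j = k %[mod N] -> gprod w j = gprod w k.
Proof.
move=> e; apply: eq_bigr => i _; apply: gsum_modn => //.
by rewrite -modnDmr e modnDmr.
Qed.

(** Reducing an entry modulo d changes the exponent by a multiple of d t = N. *)
Lemma gprod_wshift (e : 'I_d) w j : gprod (wshift e w) j = gprod w (j + e * t).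
Proof.
apply: eq_bigr => i _; apply: gsum_modn => //; rewrite val_wshift.
have NE := divisor_quoE dvd_d.
rewrite -modnDml muln_modl -NE modn_mod modnDml mulnDl.
by rewrite -addnA [(e * t + j)%N]addnC.
Qed.

Lemma sum_gprod_shift (e : 'I_d) :
  \sum_(w in Wset d) gprod w (e * t) = \sum_(w in Wset d) gprod w 0.
Proof.
rewrite [RHS](reindex_inj (wshift_inj (c := e))) /=.
apply: eq_big => [w|w _]; first by rewrite wshift_Wset.
by rewrite gprod_wshift add0n.
Qed.

(** Replacing j by j + e t leaves d j unchanged modulo N, so the sum over a full period is only
    reindexed. This makes the sum over classes well defined. *)
Lemma gratio_wshift c (e : 'I_d) w : gratio c (wshift e w) = gratio c w.
Proof.
have NE := divisor_quoE dvd_d.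
pose f j := gprod w j / G (d * j)%N * chpow T (d * j) c.
have per j : f (j + N)%N = f j.
  rewrite /f (gprod_modn _ (modnDr j N)); have e1 : d * (j + N) = d * j %[mod N].
    by rewrite mulnDr addnC modnMDl.
  by rewrite (gsum_modn psi hT e1) (chpow_modn hT _ e1).
rewrite /gratio -[RHS](sum_periodic_shift (e * t) per); apply: eq_bigr => j _.
have e1 : d * (j + e * t) = d * j %[mod N].
  by rewrite mulnDr mulnCA -NE addnC modnMDl.
by rewrite /f gprod_wshift (gsum_modn psi hT e1) (chpow_modn hT _ e1).
Qed.

Definition affine_count c : algC :=
  #|[set x : {ffun 'I_d -> F} | \sum_i x i ^+ d == c * \prod_i x i]|%:R.

Lemma affine_countE c : affine_count c =
  \sum_(x : {ffun 'I_d -> F}) (\sum_i x i ^+ d == c * \prod_i x i)%:R.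
Proof.
rewrite /affine_count -sum1_card natr_sum big_mkcond; apply: eq_bigr => x _.
by rewrite inE; case: eqP.
Qed.

Lemma card_indicator (u v : F) :
  q * (u == v)%:R = 1 + \sum_(a | a != 0) psi (a * (u - v)).
Proof.
have := sum_psi_scale psi0 psi_sum (u - v); rewrite subr_eq0 (bigD1 0) //=.
rewrite mulr0 psi0; under eq_bigr do rewrite mulrC.
by move=> ->; case: eqP; rewrite ?mulr1 ?mulr0.
Qed.

(** Off the torus the monomial vanishes and the equation does not depend on c. *)
Lemma affine_diff_torus c :
  q * (affine_count c - affine_count 0) =
  \sum_(a | a != 0) torus_sum psi n a c - \sum_(a | a != 0) torus_sum psi n a 0.
Proof.
rewrite !affine_countE -sumrB (bigID (@in_torus F n)) /= [X in _ + X]big1 ?addr0.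
  rewrite mulr_sumr -sumrB; under [RHS]eq_bigr do rewrite /torus_sum -sumrB.
  rewrite exchange_big; apply: eq_bigr => x _ /=.
  rewrite mulrBr !card_indicator sumrB; ring.
move=> x; rewrite negb_forall => /existsP[i]; rewrite negbK => /eqP xi.
have P0 : \prod_i x i = 0 by rewrite (bigD1 i) //= xi mul0r.
by rewrite P0 !mulr0 subrr.
Qed.

Lemma affine_diff c : c != 0 ->
  d%:R * (affine_count c - affine_count 0) = \sum_(w in Wset d) gratio c w.
Proof.
move=> c0; have q0 := card_natr_neq0 F; apply: (mulfI q0).
have gn k := gsum_neq0 hT psi0 psiD psi_sum k.
rewrite mulrCA affine_diff_torus mulrBr (torus_sum_total hT) // (torus_sum0 hT) //.
(* If N divides d j, the left side is -1 and the main term -q, so the correction is q - 1 = N. *)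
have coefE j : G (neg (d * j)) * chpow T (d * j) (- c) =
    q / G (d * j)%N * chpow T (d * j) c + if (t %| j)%N then N%:R else 0.
  rewrite -(dvdn_divisor_mul (ltn0Sn _) dvd_d) -mulN1r chpowM //.
  case: ifP => dj.
    rewrite !chpow_dvd ?oppr_eq0 ?oner_eq0 // !gsum_dvd // ?dvdn_neg //.
    by rewrite natr_card_pred; field.
  have := gsum_neg hT psi0 psiD psi_sum (negbT dj); set s := chpow T _ (-1).
  have ss : s * s = 1 by apply: chpowN1_sqr.
  move=> e; have -> : G (neg (d * j)) = s * q / G (d * j)%N.
    by rewrite -e [G _ * G _]mulrC mulfK.
  have -> : s * q / G (d * j)%N * (s * chpow T (d * j) c) =
     (s * s) * (q / G (d * j)%N * chpow T (d * j) c) by ring.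
  by rewrite ss mul1r addr0.
under eq_bigr => j _ do rewrite coefE mulrDl.
rewrite big_split /= -addrA [X in _ + X](_ : _ = 0) ?addr0.
  under [in RHS]eq_bigr do rewrite /gratio.
  rewrite [in RHS]exchange_big mulr_sumr; apply: eq_bigr => j _ /=.
  by rewrite !mulr_sumr; apply: eq_bigr => w _; ring.
rewrite (eq_bigr (fun j : 'I_N => if (t %| j)%N then
   N%:R * \sum_(w in Wset d) gprod w j else 0)) => [|j _]; last first.
  by case: ifP; rewrite ?mul0r.
rewrite -big_mkcond /=.
rewrite (big_ord_dvd (fun j => N%:R * \sum_(w in Wset d) gprod w j)
  (divisor_quoE dvd_d) (divisor_quo_gt0 (ltn0Sn _) dvd_d)).
(* The d corrections are equal, since j = e t only shifts W, and add up to d times the torus sum at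
   c = 0. *)
rewrite (eq_bigr (fun=> N%:R * \sum_(w in Wset d) gprod w 0)) => [|e _]; last first.
  by rewrite sum_gprod_shift.
by rewrite sumr_const card_ord -[X in X - _]mulr_natl subrr.
Qed.

Lemma affine_count0 :
  q * affine_count 0 =
  q ^+ d + N%:R * \sum_(w in Wset d | [forall i, w i != 0]) gprod w 0.
Proof.
rewrite affine_countE mulr_sumr; under eq_bigr do rewrite card_indicator.
rewrite big_split /=; congr (_ + _).
  rewrite sumr_const -natrX; congr _%:R.
  by rewrite (eq_card (B := predT)) // card_ffun card_ord.
(* In each variable the value 1 at y = 0 cancels the trivial Gauss sum -1, so the index 0 gets
   weight 0. *)
pose g (i : 'I_d) : algC := if i == 0 then 0 else G (i * t)%N.
transitivity (N%:R * \sum_(w in Wset d) \prod_(i < d) g (w i)).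
  rewrite -(sum_chars_Wset hT dvd_d) exchange_big; apply: eq_bigr => a a0 /=.
  under eq_bigr => x _ do rewrite mul0r subr0 mulr_sumr (psi_sumr psi0 psiD).
  rewrite -(bigA_distr_bigA (fun (i : 'I_d) y => psi (a * y ^+ d))) /=.
  apply: eq_bigr => i _; rewrite big_ord_recl /= /g eqxx mulr0 add0r.
  have := sum_power_psi psi hT dvd_d 0 a0; rewrite big_ord_recl /=.
  rewrite (gsum_dvd hT psi0 psi_sum) // (chpow_dvd hT _ a0) // invr1 mul1r.
  rewrite (bigD1 0) //= mul0n chpow0 mul0r add0r => e.
  rewrite (bigD1 0) //= expr0n /= mulr0 psi0.
  rewrite (eq_bigr (fun y => chpow T 0 y * psi (a * y ^+ d))) => [|y y0]; last first.
    by rewrite chpowE // expr0 mul1r.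
  rewrite e addrA subrr add0r; apply: eq_bigr => j _.
  by rewrite addn0.
congr (_ * _); rewrite [RHS]big_mkcondr; apply: eq_bigr => w _.
case: ifPn => [/forallP w0|]; last first.
  rewrite negb_forall => /existsP[i]; rewrite negbK => /eqP wi.
  by rewrite (bigD1 i) //= /g wi eqxx mul0r.
by apply: eq_bigr => i _; rewrite /g (negPf (w0 i)) addn0.
Qed.

Lemma dwork_count_gsum lam : lam != 0 ->
  (dwork_count d lam)%:R =
    (q ^+ d.-1 - 1) / (q - 1)
  + q ^+ n * greeneF (fun i : 'I_n.+1 => chpow T (i.+1 * t)%N)
                     (fun _ : 'I_n => @eps F) (lam ^- d)
  + q^-1 * \sum_(w in Wss d) \prod_(i < d) G (w i * t)%N
  + (q - 1)^-1 * sum_classes (fun C => ~~ is_zero_class C) (gratio (d%:R * lam)).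
Proof.
move=> lam0; have q0 := card_natr_neq0 F.
have q10 : q - 1 != 0 by rewrite -natr_card_pred pnatr_eq0 -lt0n card_pred_gt0.
have c0 : d%:R * lam != 0 by rewrite mulf_neq0 // natr_divisor_neq0.
set c := d%:R * lam in c0 *.
have d0 : d%:R != 0 :> algC by rewrite pnatr_eq0.
have cnt : affine_count c = (q - 1) * (dwork_count d lam)%:R + 1.
  by rewrite -natr_card_pred -natrM natr1 /affine_count card_aff.
have := affine_diff c0.
rewrite (sum_classes_zero (gratio_wshift c)) => /(mulfI d0) /eqP.
rewrite subr_eq cnt => /eqP E1.
have E2 := affine_count0.
rewrite (greene_gsum hT psi0 psiD psi_sum dvd_d lam0).
have Wz : \sum_(w in Wset d | [forall i, w i != 0]) gprod w 0 =
    \sum_(w in Wss d) \prod_(i < d) G (w i * t)%N +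
    \sum_(e < n.+1) G (e.+1 * t)%N ^+ d.
  rewrite (eq_bigr (fun w => \prod_(i < d) G (w i * t)%N)) => [|w _]; last first.
    by apply: eq_bigr => i _; rewrite addn0.
  rewrite (sum_Wset_nonzero (fun i : 'I_d => G (i * t)%N)); congr (_ + _).
  rewrite big_mkcond big_ord_recl /= add0r; apply: eq_bigr => e _.
  by rewrite /bump /= add1n.
rewrite Wz in E2.
have H0 : gratio c [ffun=> 0] =
    \sum_(j < N) G j ^+ d / G (d * j)%N * chpow T (d * j) c.
  apply: eq_bigr => j _; congr (_ / _ * _); rewrite /gprod.
  by under eq_bigr do rewrite ffunE mul0n add0n; rewrite prodr_const card_ord.
rewrite -H0; rewrite natr_card_pred in E2.
(* S collects the nonzero classes, X the zero class, Y the tuples of W** and Z the nonzero constant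
   tuples. *)
move: E1 E2; set S := sum_classes _ _; set X := gratio _ _.
set Y := \sum_(w in Wss d) _; set Z := \sum_(_ < n.+1) _.
set A0 := affine_count 0; rewrite [q ^+ d]exprS /=; set Q := q ^+ n.+1.
move=> E1 E2; have -> : (dwork_count d lam)%:R = (S + X + A0 - 1) / (q - 1).
  by rewrite -E1 addrK mulrC mulKf.
have -> : A0 = Q + (q - 1) * (Y + Z) / q.
  by apply: (mulfI q0); rewrite E2; field.
by field; rewrite q0 q10.
Qed.

End Final.

(* d = n.+2 >= 2, q = #|F|, t = (q-1)/d *)
Theorem theorem8p1 (n : nat) (F : finFieldType) (p : nat)
  (hp : p \in [pchar F])
  (hq : (#|F| = 1 %[mod n.+2])%N)
  (T : F -> algC) (hT : is_char_generator T)
  (zeta : algC) (hzeta : p.-primitive_root zeta)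
  (lam : F) (hlam : lam != 0) :
  let d := n.+2 in
  let q := #|F| in
  let t := (q.-1 %/ d)%N in
  (dwork_count d lam)%:R =
    (q%:R ^+ (d.-1) - 1) / (q%:R - 1)
  + q%:R ^+ (d - 2) *
      greeneF (fun i : 'I_n.+1 => chpow T (i.+1 * t)%N)
              (fun _ : 'I_n => @eps F)
              (lam ^- d)
  + q%:R^-1 * \sum_(w in Wss d) \prod_(i < d) gauss p zeta (chpow T (w i * t)%N)
  + (q%:R - 1)^-1 *
      sum_classes (fun C => ~~ is_zero_class C)
        (fun w => \sum_(j < q.-1)
           (\prod_(i < d) gauss p zeta (chpow T (w i * t + j)%N))
             / gauss p zeta (chpow T (d * j)%N)
           * chpow T (d * j)%N (d%:R * lam)).
Proof.
move=> d q t; have dvd_d : (d %| #|F|.-1)%N.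
  rewrite -subn1 -eqn_mod_dvd //; first by apply/eqP.
  exact: ltnW (finField_card_gt1 F).
have -> : (d - 2 = n)%N by rewrite /d subSS subSS subn0.
exact: (dwork_count_gsum hT (theta0 hp hzeta) (thetaD hp hzeta) (sum_theta hp hzeta)
          dvd_d hlam).
Qed.
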